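(* Let $\eta>0$. There are constants $a=a(\eta)>0$ and $N_0=N_0(\eta)$ such that, whenever $G$ is a finite abelian group with $|G|=N\ge N_0$ and $f\colon G\to\mathbb C$ satisfies $|f|\le1$, there is a complex $N\times N$ matrix $B$ satisfying $$\operatorname{rank}B\le N^{1-a}\qquad\text{and}\qquad \|\mathcal C_{G,f}-B\|_{1,\infty}\le N^{1/2+\eta}.$$
   Context: For a finite abelian group $G$ and $f\colon G\to\mathbb C$, the $G$-circulant is the matrix $\mathcal C_{G,f}(x,y)=f(x-y)$, $x,y\in G$. For an $N\times N$ matrix $A$, $\|A\|_{1,\infty}:=\max_{i}\sum_{j}|A_{i,j}|$. *)

(* Defs.v *)
From HB Require Import structures.
From mathcomp Require Import all_boot all_order all_algebra.
From mathcomp Require Import complex.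
From mathcomp Require Import reals exp.

Set Implicit Arguments.
Unset Strict Implicit.
Unset Printing Implicit Defensive.

Import Order.TTheory GRing.Theory Num.Theory.

Local Open Scope ring_scope.
Local Open Scope complex_scope.

(* The matrix f (x - y) with x, y in G: since 'M_n is indexed by ordinals, rows
   and columns are numbered along the enumeration of G. *)
Definition circulant (R : realType) (G : finZmodType) (f : G -> R[i]) :
    'M[R[i]]_#|G| :=
  \matrix_(i, j) f (enum_val i - enum_val j).

(* Normc.normc is the R-valued modulus (`|z| would be R[i]-valued). Row sums are
   nonnegative, so the default value 0 only matters for n = 0. *)
Definition norm1oo (R : realType) (n : nat) (A : 'M[R[i]]_n) : R :=
  \big[Num.max/0]_(i < n) \sum_(j < n) Normc.normc (A i j).

(* Main.v *)
Require Import Defs.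
From HB Require Import structures.
From mathcomp Require Import all_boot all_order all_algebra all_fingroup.
From mathcomp Require Import cyclic abelian complex separable cyclotomic.
From mathcomp Require Import reals exp.
From mathcomp Require Import ring lra zify.

(* Write C_{G,f} = U D U^* with U the unitary Fourier matrix and D the Fourier
   coefficients.  By Parseval all but few of them are at most N^(1/2 + o(1)), so it
   suffices to write U = L + S with rank L <= N^(1 - a) and the row and column sums of S
   at most N^eta: the error left is S D S^*.
   For H = Z_{n_1} x ... x Z_{n_r}, U is a tensor product of r commuting operators of
   order 4, so U = 'i^W with W a sum of r "independent" operators with eigenvalues in
   {0, 1, 2, 3}.  By Chebyshev W lies in a window of length O(sqrt r) except on a small
   proportion c of its eigenvectors; on the window 'i^W is a polynomial in W of degree
   O(sqrt r), and the row sums of that polynomial are |H|^o(1).  This gives the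
   decomposition with rank L <= c |H|, for any fixed c > 0.
   A k-th tensor power of it, in which the terms with at least eps k factors L are
   collected, turns the constant c into a power saving.  A large cyclic group is treated
   by writing its elements in base m: the difference x - y depends only on the
   differences of the digits, and {0, ..., m - 1} embeds (for differences) into a product
   of many cyclic groups of coprime orders, of total size at most 3 m.  Only the rows of U
   indexed by the group itself matter, so the enlargement costs nothing in rank.  The
   small cyclic factors, of bounded order, are grouped by order. *)

Set Implicit Arguments.
Unset Strict Implicit.
Unset Printing Implicit Defensive.

Import Order.TTheory GRing.Theory Num.Theory.

Local Open Scope ring_scope.
Local Open Scope complex_scope.

Local Notation normc := Normc.normc.

(** Joins the finite and additive structures, so that powers and products of finite abelian groups
    are again of type [finZmodType]. *)
HB.instance Definition _ (I : finType) (H : finZmodType) :=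
  GRing.Zmodule.on {ffun I -> H}.
HB.instance Definition _ (A B : finZmodType) := GRing.Zmodule.on (A * B)%type.

(** * Kernels of small rank and kernels with small row and column sums *)

Section Modulus.
Variable R : realType.
Implicit Types z w : R[i].

Lemma normc_ge0 z : 0 <= normc z.
Proof. by case: z => a b; exact: sqrtr_ge0. Qed.

Lemma ler_normcD z w : normc (z + w) <= normc z + normc w.
Proof. exact: le_normcD. Qed.

Lemma ler_normc_sum (I : finType) (P : pred I) (F : I -> R[i]) :
  normc (\sum_(i | P i) F i) <= \sum_(i | P i) normc (F i).
Proof.
elim/big_ind2: _ => [|z a w b hz hw|//]; first by rewrite Normc.normc0.
exact: le_trans (ler_normcD _ _) (lerD hz hw).
Qed.

Lemma normc_prod (I : finType) (P : pred I) (F : I -> R[i]) :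
  normc (\prod_(i | P i) F i) = \prod_(i | P i) normc (F i).
Proof.
by elim/big_ind2: _ => [|z a w b <- <-|//]; rewrite ?Normc.normc1 ?Normc.normcM.
Qed.

Lemma normcX z n : normc (z ^+ n) = normc z ^+ n.
Proof.
by elim: n => [|n IH]; rewrite ?expr0 ?Normc.normc1 // !exprS Normc.normcM IH.
Qed.

Lemma normc_real (a : R) : normc a%:C = `|a|.
Proof. by rewrite /Normc.normc /= expr0n /= addr0 sqrtr_sqr. Qed.

Lemma normc_nat n : normc (n%:R : R[i]) = n%:R.
Proof.
have -> : (n%:R : R[i]) = (n%:R : R)%:C by rewrite rmorph_nat.
by rewrite normc_real ger0_norm ?ler0n.
Qed.

Lemma normc_opp z : normc (- z) = normc z.
Proof. by case: z => a b /=; rewrite !sqrrN. Qed.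

Lemma normc_i : normc ('i : R[i]) = 1.
Proof. by rewrite /Normc.normc /= expr0n expr1n add0r sqrtr1. Qed.

Lemma normc_conj z : normc (conjc z) = normc z.
Proof. by case: z => a b /=; rewrite sqrrN. Qed.

Lemma mulr_conjc z : z * conjc z = (normc z ^+ 2)%:C.
Proof.
case: z => a b /=; rewrite sqr_sqrtr ?addr_ge0 ?sqr_ge0 //.
by apply/eqP; rewrite eq_complex /=; apply/andP; split; apply/eqP; ring.
Qed.

End Modulus.

Section Kernels.
Variable R : realType.
Local Notation C := R[i].

(** Rows and columns are bounded together so that the bound passes to adjoints and compositions; the
    error term involves both S and its adjoint. *)
Definition l1_le (X Y : finType) (K : X -> Y -> C) (s : R) :=
  (forall x, \sum_y normc (K x y) <= s) /\
  (forall y, \sum_x normc (K x y) <= s).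

(** Rank as the size of a factorization: tensor products, restrictions and compositions act directly
    on the two factors. *)
Definition rank_le (X Y : finType) (K : X -> Y -> C) (r : R) :=
  exists (I : finType) (u : X -> I -> C) (v : I -> Y -> C),
    #|I|%:R <= r /\ forall x y, K x y = \sum_i u x i * v i y.

Definition splits (X Y : finType) (K : X -> Y -> C) (r s : R) :=
  exists S : X -> Y -> C,
    rank_le (fun x y => K x y - S x y) r /\ l1_le S s.

Lemma l1_le_ext (X Y : finType) (K K' : X -> Y -> C) s :
  K =2 K' -> l1_le K s -> l1_le K' s.
Proof.
by move=> e [h1 h2]; split=> [x|y]; [move: (h1 x) | move: (h2 y)];
  under eq_bigr do rewrite e.
Qed.

Lemma l1_leW (X Y : finType) (K : X -> Y -> C) s s' :
  s <= s' -> l1_le K s -> l1_le K s'.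
Proof. by move=> h [h1 h2]; split=> z; apply: le_trans h. Qed.

Lemma l1_leD (X Y : finType) (K K' : X -> Y -> C) s s' :
  l1_le K s -> l1_le K' s' -> l1_le (fun x y => K x y + K' x y) (s + s').
Proof.
by move=> [h1 h2] [h3 h4]; split=> z;
  [apply: le_trans (lerD (h1 z) (h3 z)) | apply: le_trans (lerD (h2 z) (h4 z))];
  rewrite -big_split ler_sum // => i _; exact: ler_normcD.
Qed.

Lemma l1_leZ (X Y : finType) (K : X -> Y -> C) s (c : C) :
  l1_le K s -> l1_le (fun x y => c * K x y) (normc c * s).
Proof.
by move=> [h1 h2]; split=> z; under eq_bigr do rewrite Normc.normcM;
  rewrite -mulr_sumr ler_wpM2l ?normc_ge0.
Qed.

Lemma l1_le_sum (X Y T : finType) (P : pred T) (K : T -> X -> Y -> C) (s : T -> R) :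
  (forall t, P t -> l1_le (K t) (s t)) ->
  l1_le (fun x y => \sum_(t | P t) K t x y) (\sum_(t | P t) s t).
Proof.
move=> h; split=> z; apply: le_trans (_ : \sum_i \sum_(t | P t) _ <= _).
- by apply: ler_sum => i _; exact: ler_normc_sum.
- by rewrite exchange_big; apply: ler_sum => t /h [].
- by apply: ler_sum => i _; exact: ler_normc_sum.
- by rewrite exchange_big; apply: ler_sum => t /h [].
Qed.

Lemma l1_le_comp (X Y Z : finType) (K : X -> Y -> C) (K' : Y -> Z -> C) s s' :
  0 <= s -> 0 <= s' -> l1_le K s -> l1_le K' s' ->
  l1_le (fun x z => \sum_y K x y * K' y z) (s * s').
Proof.
move=> s0 s0' [h1 h2] [h3 h4]; split=> [x|z].
  apply: le_trans (_ : \sum_z \sum_y normc (K x y) * normc (K' y z) <= _).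
    apply: ler_sum => z _; apply: le_trans (ler_normc_sum _ _) _.
    by apply: ler_sum => y _; rewrite Normc.normcM.
  rewrite exchange_big /=; under eq_bigr do rewrite -mulr_sumr.
  apply: le_trans (_ : \sum_y normc (K x y) * s' <= _).
    by apply: ler_sum => y _; rewrite ler_wpM2l ?normc_ge0.
  by rewrite -mulr_suml ler_wpM2r.
apply: le_trans (_ : \sum_x \sum_y normc (K x y) * normc (K' y z) <= _).
  apply: ler_sum => x _; apply: le_trans (ler_normc_sum _ _) _.
  by apply: ler_sum => y _; rewrite Normc.normcM.
rewrite exchange_big /=; under eq_bigr do rewrite -mulr_suml.
apply: le_trans (_ : \sum_y s * normc (K' y z) <= _).
  by apply: ler_sum => y _; rewrite ler_wpM2r ?normc_ge0.
by rewrite -mulr_sumr ler_wpM2l.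
Qed.

Lemma l1_le_id (X : finType) : l1_le (fun x y : X => (x == y)%:R : C) 1.
Proof.
split=> z; rewrite (bigD1 z) //= eqxx Normc.normc1 big1 ?addr0 // => i ne.
  by rewrite eq_sym (negbTE ne) Normc.normc0.
by rewrite (negbTE ne) Normc.normc0.
Qed.

Lemma l1_le_pair (X Y X' Y' : finType) (K : X -> Y -> C) (K' : X' -> Y' -> C) s s' :
  0 <= s -> l1_le K s -> l1_le K' s' ->
  l1_le (fun (x : X * X') (y : Y * Y') => K x.1 y.1 * K' x.2 y.2) (s * s').
Proof.
move=> s0 [h1 h2] [h3 h4]; split=> -[a b].
  have -> : \sum_y normc (K (a, b).1 y.1 * K' (a, b).2 y.2) =
            (\sum_y normc (K a y)) * (\sum_y normc (K' b y)).
    rewrite big_distrl /=; under [RHS]eq_bigr do rewrite big_distrr /=.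
    by rewrite pair_big; apply: eq_bigr => y _; rewrite Normc.normcM.
  by rewrite ler_pM // sumr_ge0 // => i _; exact: normc_ge0.
have -> : \sum_x normc (K x.1 (a, b).1 * K' x.2 (a, b).2) =
          (\sum_x normc (K x a)) * (\sum_x normc (K' x b)).
  rewrite big_distrl /=; under [RHS]eq_bigr do rewrite big_distrr /=.
  by rewrite pair_big; apply: eq_bigr => y _; rewrite Normc.normcM.
by rewrite ler_pM // sumr_ge0 // => i _; exact: normc_ge0.
Qed.

Lemma l1_le_ffun (I X Y : finType) (K : I -> X -> Y -> C) (s : I -> R) :
  (forall i, l1_le (K i) (s i)) ->
  l1_le (fun (x : {ffun I -> X}) (y : {ffun I -> Y}) => \prod_i K i (x i) (y i))
    (\prod_i s i).
Proof.
move=> h; split=> z /=; under eq_bigr do rewrite normc_prod.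
  rewrite -(bigA_distr_bigA (fun i y => normc (K i (z i) y))) /=.
  apply: ler_prod => i _; rewrite (h i).1 andbT sumr_ge0 // => y _; exact: normc_ge0.
rewrite -(bigA_distr_bigA (fun i x => normc (K i x (z i)))) /=.
by apply: ler_prod => i _; rewrite (h i).2 andbT sumr_ge0 // => y _; exact: normc_ge0.
Qed.

Lemma rank_le_ext (X Y : finType) (K K' : X -> Y -> C) r :
  K =2 K' -> rank_le K r -> rank_le K' r.
Proof. by move=> e [I [u [v [h1 h2]]]]; exists I, u, v; split=> // x y; rewrite -e. Qed.

Lemma rank_leW (X Y : finType) (K : X -> Y -> C) r r' :
  r <= r' -> rank_le K r -> rank_le K r'.
Proof. by move=> h [I [u [v [h1 h2]]]]; exists I, u, v; split=> //; apply: le_trans h. Qed.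

Lemma rank_le_index (X Y I : finType) (P : pred I) (u : X -> I -> C) (v : I -> Y -> C) :
  rank_le (fun x y => \sum_(i | P i) u x i * v i y) #|P|%:R.
Proof.
exists {i in P}, (fun x i => u x (val i)), (fun i y => v (val i) y).
by split=> [|x y]; rewrite ?card_sig // -(big_sub P (fun i => u x i * v i y)).
Qed.

Lemma rank_le0 (X Y : finType) : rank_le (fun (_ : X) (_ : Y) => 0 : C) 0.
Proof.
exists void, (fun _ _ => 0), (fun _ _ => 0); split=> [|x y].
  by rewrite card_void.
by rewrite big1 // => i _; rewrite mul0r.
Qed.

Lemma rank_leD (X Y : finType) (K K' : X -> Y -> C) r r' :
  rank_le K r -> rank_le K' r' -> rank_le (fun x y => K x y + K' x y) (r + r').
Proof.
move=> [I [u [v [h1 h2]]]] [J [u' [v' [h3 h4]]]].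
exists (I + J)%type, (fun x i => match i with inl i => u x i | inr i => u' x i end),
  (fun i y => match i with inl i => v i y | inr i => v' i y end).
by split=> [|x y]; [rewrite card_sum natrD lerD | rewrite big_sumType h2 h4].
Qed.

Lemma rank_le_sum (X Y T : finType) (P : pred T) (K : T -> X -> Y -> C) (r : T -> R) :
  (forall t, P t -> rank_le (K t) (r t)) ->
  rank_le (fun x y => \sum_(t | P t) K t x y) (\sum_(t | P t) r t).
Proof.
move=> h; elim: (index_enum T) => [|t s IH].
  by rewrite big_nil; apply: rank_le_ext (@rank_le0 X Y) => x y; rewrite big_nil.
rewrite big_cons; case: ifP => [Pt|Pt].
  by apply: rank_le_ext (rank_leD (h t Pt) IH) => x y; rewrite big_cons Pt.
by apply: rank_le_ext IH => x y; rewrite big_cons Pt.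
Qed.

Lemma rank_le_compr (X Y Z : finType) (K : X -> Y -> C) (A : Y -> Z -> C) r :
  rank_le K r -> rank_le (fun x z => \sum_y K x y * A y z) r.
Proof.
move=> [I [u [v [h1 h2]]]]; exists I, u, (fun i z => \sum_y v i y * A y z).
split=> // x z; under [RHS]eq_bigr do rewrite big_distrr /=.
rewrite exchange_big; apply: eq_bigr => y _; rewrite h2 big_distrl /=.
by apply: eq_bigr => i _; rewrite mulrA.
Qed.

Lemma rank_le_tr (X Y : finType) (K : X -> Y -> C) r :
  rank_le K r -> rank_le (fun y x => K x y) r.
Proof.
move=> [I [u [v [h1 h2]]]]; exists I, (fun y i => v i y), (fun i x => u x i).
by split=> // x y; rewrite h2; apply: eq_bigr => i _; rewrite mulrC.
Qed.

Lemma rank_le_compl (X Y Z : finType) (K : X -> Y -> C) (A : Y -> Z -> C) r :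
  rank_le A r -> rank_le (fun x z => \sum_y K x y * A y z) r.
Proof.
move=> /rank_le_tr /(@rank_le_compr _ _ _ _ (fun y x => K x y)) /rank_le_tr.
by apply: rank_le_ext => x z; apply: eq_bigr => y _; rewrite mulrC.
Qed.

Lemma rank_le_row (X Y : finType) (K : X -> Y -> C) : rank_le K #|X|%:R.
Proof.
exists X, (fun x x' => (x == x')%:R), K; split=> // x y.
rewrite (bigD1 x) //= eqxx mul1r big1 ?addr0 // => i ne.
by rewrite eq_sym (negbTE ne) mul0r.
Qed.

Lemma rank_le_restrict (X' Y' X Y : finType) (a : X' -> X) (b : Y' -> Y)
    (K : X -> Y -> C) r :
  rank_le K r -> rank_le (fun x y => K (a x) (b y)) r.
Proof.
move=> [I [u [v [h1 h2]]]]; exists I, (fun x => u (a x)), (fun i y => v i (b y)).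
by split.
Qed.

Lemma rank_le_pair (X Y X' Y' : finType) (K : X -> Y -> C) (K' : X' -> Y' -> C) r r' :
  rank_le K r -> rank_le K' r' ->
  rank_le (fun (x : X * X') (y : Y * Y') => K x.1 y.1 * K' x.2 y.2) (r * r').
Proof.
move=> [I [u [v [h1 h2]]]] [J [u' [v' [h3 h4]]]].
exists (I * J)%type, (fun x i => u x.1 i.1 * u' x.2 i.2),
  (fun i y => v i.1 y.1 * v' i.2 y.2).
split=> [|x y]; first by rewrite card_prod natrM ler_pM.
rewrite h2 h4 big_distrl /=; under eq_bigr do rewrite big_distrr /=.
by rewrite pair_big; apply: eq_bigr => i _ /=; rewrite mulrACA.
Qed.

(** Ranks multiply under tensor products. Since the index type of the i-th factorization depends on
    [b i], both types are placed in the sum [A1 + A0], and the product is indexed by the functions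
    whose i-th value lies in the summand selected by [b i]. *)
Lemma rank_le_ffun (I X Y : finType) (K : bool -> X -> Y -> C) (r : bool -> R)
    (b : I -> bool) :
  (forall c, rank_le (K c) (r c)) ->
  rank_le (fun (x : {ffun I -> X}) (y : {ffun I -> Y}) =>
    \prod_i K (b i) (x i) (y i)) (\prod_i r (b i)).
Proof.
move=> h; have [A1 [u1 [v1 [h1 e1]]]] := h true.
have [A0 [u0 [v0 [h0 e0]]]] := h false.
pose u x (a : A1 + A0) := match a with inl a => u1 x a | inr a => u0 x a end.
pose v (a : A1 + A0) y := match a with inl a => v1 a y | inr a => v0 a y end.
pose Q c := [pred a : A1 + A0 | (if a is inl _ then true else false) == c].
have cQ c : #|Q c|%:R <= r c.
  case: c; [apply: le_trans h1 | apply: le_trans h0]; rewrite -sum1_card big_sumType /=.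
    by rewrite [X in (_ + X)%N]big_pred0 // addn0 sum1_card.
  by rewrite [X in (X + _)%N]big_pred0 // add0n sum1_card.
have eK c x y : K c x y = \sum_(a | Q c a) u x a * v a y.
  case: c; rewrite big_sumType /= ?e1 ?e0.
    by rewrite [X in _ + X]big_pred0 // addr0.
  by rewrite [X in X + _]big_pred0 // add0r.
have := @rank_le_index {ffun I -> X} {ffun I -> Y} {ffun I -> A1 + A0}
  (mem (family (fun i => Q (b i)))) (fun x g => \prod_i u (x i) (g i))
  (fun g y => \prod_i v (g i) (y i)).
move=> H; apply: rank_leW (rank_le_ext _ H).
  rewrite card_family; rewrite /image_mem foldrE big_map big_enum /=.
  by rewrite natr_prod; apply: ler_prod => i _; rewrite ler0n cQ.
move=> x y /=; under [RHS]eq_bigr do rewrite eK.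
rewrite (bigA_distr_big_dep _ (fun i a => u (x i) a * v a (y i))) /=.
by apply: eq_big => // g _; rewrite big_split.
Qed.

End Kernels.

(** * Characters and circulants *)

Section Fourier.
Variable R : realType.
Local Notation C := R[i].

(** H indexes its own dual: the functions [e _ z] are the characters, and the last clause is the
    orthogonality relation behind Fourier inversion. *)
Definition bichar (H : finZmodType) (e : H -> H -> C) :=
  [/\ forall x y z, e (x + y) z = e x z * e y z,
      forall x z, normc (e x z) = 1 &
      forall x, \sum_z e x z = (x == 0)%:R * #|H|%:R].

Definition dft (H : finZmodType) (e : H -> H -> C) (x z : H) : C :=
  e x z / (Num.sqrt (#|H|%:R : R))%:C.

Section Bichar.
Variables (H : finZmodType) (e : H -> H -> C).
Hypothesis he : bichar e.

Lemma card_zmod_gt0 (G : finZmodType) : (0 < #|G|)%N.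
Proof. by apply/card_gt0P; exists 0. Qed.

Lemma sqrt_card_gt0 (G : finZmodType) : 0 < Num.sqrt (#|G|%:R : R).
Proof. by rewrite sqrtr_gt0 ltr0n card_zmod_gt0. Qed.

Lemma sqrt_card_neq0 (G : finZmodType) : (Num.sqrt (#|G|%:R : R))%:C != 0.
Proof. by rewrite (inj_eq (@complexI _)) gt_eqF ?sqrt_card_gt0. Qed.

Lemma sqrt_card_sqr (G : finZmodType) :
  (Num.sqrt (#|G|%:R : R))%:C * (Num.sqrt (#|G|%:R : R))%:C = #|G|%:R.
Proof. by rewrite -rmorphM /= -expr2 sqr_sqrtr ?ler0n // rmorph_nat. Qed.

Lemma bichar0 z : e 0 z = 1.
Proof.
case: he => hD h1 _; have := hD 0 0 z; rewrite addr0 => /esym/eqP.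
rewrite -subr_eq0 -{3}[e 0 z]mulr1 -mulrBr mulf_eq0 subr_eq0 => /orP[/eqP h0|/eqP //].
by have := h1 0 z; rewrite h0 Normc.normc0 => /eqP; rewrite eq_sym oner_eq0.
Qed.

Lemma bicharN x z : e (- x) z = conjc (e x z).
Proof.
case: he => hD h1 _.
have nz : e x z != 0.
  by apply/eqP => h0; have := h1 x z; rewrite h0 Normc.normc0 => /eqP; rewrite eq_sym oner_eq0.
apply: (mulfI nz); rewrite -hD subrr bichar0 mulr_conjc h1 expr1n.
by [].
Qed.

Definition fourier (f : H -> C) z := \sum_x f x * conjc (e x z).

Lemma fourier_inv f h : \sum_z fourier f z * e h z = #|H|%:R * f h.
Proof.
case: he => hD h1 h2; rewrite /fourier.
under eq_bigr do rewrite big_distrl /=.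
rewrite exchange_big /=.
under eq_bigr => x _ do under eq_bigr => z _ do rewrite -mulrA -bicharN -hD.
under eq_bigr => x _ do rewrite -mulr_sumr h2.
rewrite (bigD1 h) //= addNr eqxx mul1r big1 ?addr0 1?mulrC // => x ne.
by rewrite addrC subr_eq0 eq_sym (negbTE ne) mul0r mulr0.
Qed.

Lemma conjc_sum (I : finType) (P : pred I) (F : I -> C) :
  conjc (\sum_(i | P i) F i) = \sum_(i | P i) conjc (F i).
Proof. exact: (raddf_sum (@conjc R)). Qed.

Lemma conjcM (z w : C) : conjc (z * w) = conjc z * conjc w.
Proof. exact: (rmorphM (@conjc R)). Qed.

Lemma conjcB (z w : C) : conjc (z - w) = conjc z - conjc w.
Proof. exact: (rmorphB (@conjc R)). Qed.

(** Expanding the conjugate factor of each square leaves, for every y, the inversion formula at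
    y. *)
Lemma parseval f :
  \sum_z normc (fourier f z) ^+ 2 = #|H|%:R * \sum_x normc (f x) ^+ 2.
Proof.
apply: (@complexI R); rewrite rmorphM !rmorph_sum rmorph_nat /=.
under eq_bigr => z _ do rewrite -mulr_conjc {2}/fourier conjc_sum big_distrr /=.
rewrite exchange_big big_distrr /=; apply: eq_bigr => y _.
rewrite -mulr_conjc mulrA -fourier_inv big_distrl /=; apply: eq_bigr => z _.
by rewrite conjcM conjcK mulrA mulrAC.
Qed.

(** Each coefficient above t contributes at least t^2 to the Parseval sum, which is at most
    |H|^2. *)
Lemma parseval_tail f (t : R) : 0 < t -> (forall x, normc (f x) <= 1) ->
  #|[pred z | t < normc (fourier f z)]|%:R <= (#|H|%:R / t) ^+ 2.
Proof.
move=> t0 hf; rewrite expr_div_n ler_pdivlMr ?exprn_gt0 //.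
apply: le_trans (_ : \sum_z normc (fourier f z) ^+ 2 <= _); last first.
  rewrite parseval expr2 ler_wpM2l //.
  rewrite -sum1_card natr_sum; apply: ler_sum => x _.
  by rewrite exprn_ile1 ?normc_ge0.
rewrite mulrC mulr_natr -sumr_const big_mkcond; apply: ler_sum => z _.
case: ifP => [|_]; last by rewrite sqr_ge0.
rewrite inE => /ltW h; rewrite ler_sqr ?nnegrE //; [exact: ltW | exact: normc_ge0].
Qed.

(** The characters diagonalize the circulants of H: this is inversion at x - y, with |H| distributed
    as two square roots. *)
Lemma dft_conv f x y :
  f (x - y) = \sum_z dft e x z * (fourier f z * conjc (dft e y z)).
Proof.
have nz : (#|H|%:R : C) != 0 by rewrite pnatr_eq0 -lt0n card_zmod_gt0.
case: he => hD h1 h2.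
apply: (mulfI nz); rewrite -fourier_inv big_distrr /=; apply: eq_bigr => z _.
rewrite /dft hD bicharN conjcM.
have -> : conjc (((Num.sqrt (#|H|%:R : R))%:C)^-1) = ((Num.sqrt (#|H|%:R : R))%:C)^-1.
  by rewrite -fmorphV /= oppr0.
rewrite -sqrt_card_sqr; have := sqrt_card_neq0 H; set s := (_)%:C => s0.
by field.
Qed.

(** Every entry has modulus |H|^(-1/2), and each row or column has |H| entries. *)
Lemma dft_trivial_bound : l1_le (dft e) (Num.sqrt #|H|%:R).
Proof.
have hn x z : normc (dft e x z) = (Num.sqrt #|H|%:R)^-1.
  case: he => _ h1 _; rewrite /dft Normc.normcM h1 mul1r -fmorphV normc_real.
  by rewrite ger0_norm // invr_ge0 sqrtr_ge0.
have hs : (Num.sqrt #|H|%:R)^-1 *+ #|H| = Num.sqrt #|H|%:R :> R.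
  rewrite -[LHS]mulr_natr; have := @sqr_sqrtr _ (#|H|%:R : R) (ler0n _ _).
  have := sqrt_card_gt0 H; set s := Num.sqrt _ => s0 <-.
  by rewrite expr2 mulKf // gt_eqF.
by split=> t; under eq_bigr do rewrite hn; rewrite sumr_const hs.
Qed.

End Bichar.

Lemma rank_le_conj (X Y : finType) (K : X -> Y -> C) r :
  rank_le K r -> rank_le (fun x y => conjc (K x y)) r.
Proof.
move=> [I [u [v [h1 h2]]]].
exists I, (fun x i => conjc (u x i)), (fun i y => conjc (v i y)); split=> // x y.
by rewrite h2 conjc_sum; apply: eq_bigr => i _; rewrite conjcM.
Qed.

(* The kernel is U D U^*, with U the transform and D the Fourier coefficients;
   the coefficients above t are few, and for the others replace U by its cheap part S. *)
Lemma circulant_split (G H : finZmodType) (e : H -> H -> C) (phi : G -> H)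
    (psi : H -> G) (f : G -> C) (r s t : R) :
  bichar e -> (forall x y, psi (phi x - phi y) = x - y) ->
  (forall x, normc (f x) <= 1) -> 0 <= s -> 0 < t ->
  splits (fun x z => dft e (phi x) z) r s ->
  splits (fun x y => f (x - y)) (r + r + (#|H|%:R / t) ^+ 2) (s * (t * s)).
Proof.
move=> he hpsi hf s0 t0 [S [hL hS]].
(* The function [f] is transported to H by [psi]; between the rows [phi x] and [phi y] the circulant
   of H then has the entry f (x - y). *)
pose fh := fourier e (fun h => f (psi h)).
pose bg := [pred z | t < normc (fh z)].
pose D z := if bg z then 0 else fh z.
exists (fun x y => \sum_z S x z * (D z * conjc (S y z))); split; last first.
  apply: l1_le_comp; rewrite ?mulr_ge0 // ?(ltW t0) //.
  have := l1_le_comp (K := fun z z' => (z == z')%:R * D z)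
    (K' := fun z y => conjc (S y z)) (ltW t0) s0.
  move=> H1; apply: l1_le_ext (H1 _ _).
  - move=> z y; rewrite (bigD1 z) //= eqxx mul1r big1 ?addr0 // => z' ne.
    by rewrite eq_sym (negbTE ne) !mul0r.
  - have hD z : normc (D z) <= t.
      by rewrite /D /=; case: ltP => // _; rewrite Normc.normc0 ltW.
    split=> z.
      rewrite (bigD1 z) //= eqxx mul1r big1 ?addr0 // => z' ne.
      by rewrite eq_sym (negbTE ne) mul0r Normc.normc0.
    rewrite (bigD1 z) //= eqxx mul1r big1 ?addr0 // => z' ne.
    by rewrite (negbTE ne) mul0r Normc.normc0.
  - by case: hS => h1 h2; split=> z; under eq_bigr do rewrite normc_conj.
have hB : rank_le (fun x y => \sum_(z | bg z) dft e (phi x) z *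
    (fh z * conjc (dft e (phi y) z))) ((#|H|%:R / t) ^+ 2).
  apply: rank_leW (rank_le_index bg (fun x z => dft e (phi x) z)
    (fun z y => fh z * conjc (dft e (phi y) z))).
  exact: parseval_tail.
(* With a prime for adjoints, U D U' - S D S' = (U - S) D U' + S D (U - S)'; the large coefficients,
   removed from D, are accounted for by [hB]. *)
have h1 := rank_le_compr (fun z y => D z * conjc (dft e (phi y) z)) hL.
have h2 := rank_le_compl (fun x z => S x z * D z) (rank_le_tr (rank_le_conj hL)).
apply: rank_le_ext (rank_leD (rank_leD h1 h2) hB) => x y.
rewrite /= -hpsi (@dft_conv _ _ he (fun h => f (psi h))) -/fh.
rewrite [X in _ = X - _](bigID bg) /=.
rewrite [X in _ + X = _]big_mkcond [X in _ = X + _ - _]big_mkcond /=.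
rewrite [X in _ = _ + X - _]big_mkcond -!big_split -sumrB /=.
apply: eq_bigr => z _; rewrite /D /= conjcB; case: ifP => _ /=; ring.
Qed.

Lemma splits_circulant (G : finZmodType) (f : G -> C) (r s : R) : 0 <= s ->
  splits (fun x y => f (x - y)) r s ->
  exists B : 'M[C]_#|G|, (\rank B)%:R <= r /\ norm1oo (circulant f - B) <= s.
Proof.
move=> s0 [S [[I [u [v [hr hK]]]] [hS _]]].
exists ((\matrix_(i < #|G|, k < #|I|) u (enum_val i) (enum_val k)) *m
        (\matrix_(k < #|I|, j < #|G|) v (enum_val k) (enum_val j))); split.
  by apply: le_trans hr; rewrite ler_nat mulmx_max_rank.
rewrite /norm1oo; apply/bigmax_leP; split=> // i _.
apply: le_trans (hS (enum_val i)).
rewrite (reindex (@enum_val G predT)) /=; last exact/onW_bij/enum_val_bij.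
apply: ler_sum => j _; rewrite !mxE.
under eq_bigr do rewrite !mxE.
rewrite -(reindex (@enum_val I predT) (P := xpredT)
  (F := fun k => u (enum_val i) k * v k (enum_val j))); last exact/onW_bij/enum_val_bij.
by rewrite -hK opprB addrC subrK.
Qed.

End Fourier.

(** * Groups whose Fourier transform splits, and their products *)

Section Tame.
Variable R : realType.
Local Notation C := R[i].

(** A Freiman-type embedding: phi need not be additive, but phi x - phi y determines x - y, which is
    all that a circulant sees. *)
Definition embeds (G H : finZmodType) (phi : G -> H) (psi : H -> G) :=
  forall x y, psi (phi x - phi y) = x - y.

(* The transform is only required on the rows coming from G: this keeps all ranks
   bounded in terms of #|G|, so that enlarging G to H costs nothing in rank. *)
Definition tame (G : finZmodType) (eta a K : R) :=
  exists (H : finZmodType) (e : H -> H -> C) (phi : G -> H) (psi : H -> G),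
    [/\ bichar e, embeds phi psi, #|H|%:R <= K * #|G|%:R `^ (1 + eta) &
        splits (fun x z => dft e (phi x) z)
          (K * #|G|%:R `^ (1 - a)) (K * #|G|%:R `^ eta)].

Definition tame_class (P : finZmodType -> Prop) (eta : R) :=
  exists a K : R, [/\ 0 < a, 1 <= K & forall G, P G -> tame G eta a K].

Lemma powR_large (a K : R) : 0 < a ->
  exists N0 : nat, forall n, (N0 <= n)%N -> K <= n%:R `^ a.
Proof.
move=> a0; pose K' := Num.max K 1.
have K1 : 1 <= K' by rewrite le_max lexx orbT.
exists (Num.truncn (K' `^ a^-1)).+1 => n hn.
apply: le_trans (_ : K' <= _); first by rewrite le_max lexx.
have h : K' `^ a^-1 <= n%:R.
  by apply: ltW; apply: lt_le_trans (truncnS_gt _) _; rewrite ler_nat.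
have -> : K' = (K' `^ a^-1) `^ a.
  by rewrite -powRrM mulVf ?gt_eqF // powRr1 // (le_trans ler01).
by apply: ge0_ler_powR; rewrite ?nnegrE ?powR_ge0 ?(ltW a0).
Qed.

Lemma powR_add (x a b : R) : 0 < x -> x `^ (a + b) = x `^ a * x `^ b.
Proof. by move=> x0; rewrite powRD // (gt_eqF x0) implybT. Qed.

Lemma card_zmod_ge1 (G : finZmodType) : 1 <= (#|G|%:R : R).
Proof. by rewrite ler1n card_zmod_gt0. Qed.

Lemma circulant_of_tame (eta : R) : 0 < eta ->
  tame_class (fun _ => True) (eta / 8) ->
  exists (a : R) (N0 : nat),
    0 < a /\
    forall (G : finZmodType) (f : G -> R[i]),
      (N0 <= #|G|)%N ->
      (forall x : G, normc (f x) <= 1) ->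
      exists B : 'M[R[i]]_#|G|,
        (\rank B)%:R <= (#|G|%:R : R) `^ (1 - a) /\
        norm1oo (circulant f - B) <= (#|G|%:R : R) `^ (1 / 2 + eta).
Proof.
move=> eta0 [a [K [a0 K1 ht]]]; pose e' := eta / 8.
have e0 : 0 < e' by rewrite divr_gt0.
(* The two parts of the rank save the exponents a and 2 e'; half of the smaller one is given up to
   absorb the constant K + K + K^2. *)
pose b := Num.min a (2 * e') / 2.
have b0 : 0 < b by rewrite divr_gt0 // lt_min a0 mulr_gt0.
have b1 : 2 * b <= a by rewrite /b mulrC divfK ?pnatr_eq0 // ge_min lexx.
have b2 : 2 * b <= 2 * e' by rewrite /b mulrC divfK ?pnatr_eq0 // ge_min lexx orbT.
have K0 : 0 <= K by apply: le_trans K1.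
have [N1 h1] := @powR_large b (K + K + K ^+ 2) b0.
have [N2 h2] := @powR_large (4 * e') (K ^+ 2) (mulr_gt0 (ltr0n _ 4) e0).
exists b, (maxn N1 N2); split=> // G f; rewrite geq_max => /andP[hN1 hN2] hf.
have [H [e [phi [psi [he hemb hH hs]]]]] := ht G I.
have n1 := card_zmod_ge1 G; set n : R := #|G|%:R in n1 hH hs h1 h2 *.
have n0 : 0 < n by apply: lt_le_trans n1.
(* At this threshold the number of large coefficients is at most K^2 n^(1 - 2 e'), and the error is
   K^2 n^(1/2 + 4 e'); the remaining 4 e' = eta / 2 absorbs K^2. *)
have t0 : 0 < n `^ (1 / 2 + 2 * e') by rewrite powR_gt0.
have s0 : 0 <= K * n `^ e' by rewrite mulr_ge0 ?powR_ge0.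
have := circulant_split he hemb hf s0 t0 hs.
case/splits_circulant => [|B [hB1 hB2]].
  by rewrite !mulr_ge0 ?powR_ge0.
exists B; split.
- apply: le_trans hB1 _.
  apply: le_trans (_ : (K + K + K ^+ 2) * n `^ (1 - 2 * b) <= _); last first.
    have -> : 1 - b = b + (1 - 2 * b) by ring.
    by rewrite (powR_add b) // ler_wpM2r ?powR_ge0 ?h1.
  rewrite (mulrDl (K + K)) (mulrDl K) -!addrA.
  have ha : K * n `^ (1 - a) <= K * n `^ (1 - 2 * b).
    by rewrite ler_wpM2l // ler_powR // lerB.
  apply: lerD => //; apply: lerD => //.
  apply: le_trans (_ : (K * n `^ (1 / 2 - e')) ^+ 2 <= _).
    rewrite ler_pXn2r // ?nnegrE ?divr_ge0 ?mulr_ge0 ?powR_ge0 //.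
    rewrite ler_pdivrMr // -mulrA -powR_add //.
    by have -> : 1 / 2 - e' + (1 / 2 + 2 * e') = 1 + e' by field.
  rewrite exprMn ler_wpM2l ?exprn_ge0 // expr2 -powR_add // ler_powR //.
  have -> : 1 / 2 - e' + (1 / 2 - e') = 1 - 2 * e' by field.
  by rewrite lerB.
- apply: le_trans hB2 _.
  have -> : K * n `^ e' * (n `^ (1 / 2 + 2 * e') * (K * n `^ e')) =
     K ^+ 2 * (n `^ (e' + (1 / 2 + 2 * e') + e')) by rewrite !powR_add //; ring.
  have -> : 1 / 2 + eta = 4 * e' + (e' + (1 / 2 + 2 * e') + e') by rewrite /e'; field.
  by rewrite (powR_add (4 * e')) // ler_wpM2r ?powR_ge0 // h2.
Qed.

Lemma tame_le (G : finZmodType) (eta eta' a a' K K' : R) :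
  eta <= eta' -> a' <= a -> 0 <= K -> K <= K' -> tame G eta a K -> tame G eta' a' K'.
Proof.
move=> h1 h2 K0 h3 [H [e [phi [psi [he hemb hH [S [hL hS]]]]]]].
have n1 := card_zmod_ge1 G.
have hp x y : x <= y -> K * #|G|%:R `^ x <= K' * #|G|%:R `^ y.
  by move=> xy; apply: ler_pM; rewrite ?powR_ge0 // ler_powR.
exists H, e, phi, psi; split=> //; first by apply: le_trans hH _; apply: hp; rewrite lerD2l.
exists S; split; [apply: rank_leW hL | apply: l1_leW hS]; apply: hp => //.
by rewrite lerB.
Qed.

Lemma embeds_inj (G H : finZmodType) (phi : G -> H) (psi : H -> G) :
  embeds phi psi -> injective phi.
Proof.
by move=> h x y xy; apply/eqP; rewrite -subr_eq0 -h xy h subrr.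
Qed.

Lemma l1_le_inj (X' X Y : finType) (K : X -> Y -> C) (phi : X' -> X) s :
  injective phi -> l1_le K s -> l1_le (fun x => K (phi x)) s.
Proof.
move=> inj [h1 h2]; split=> // y; apply: le_trans (h2 y).
rewrite -[leLHS](big_imset (A := predT) (fun x => normc (K x y)) (in2W inj)) /=.
by rewrite [leRHS](bigID (mem (phi @: predT))) /= lerDl sumr_ge0 // => x _; exact: normc_ge0.
Qed.

Lemma tame_embed (G G' : finZmodType) (phi0 : G -> G') (psi0 : G' -> G) (eta a K : R) :
  embeds phi0 psi0 -> #|G| = #|G'| -> tame G' eta a K -> tame G eta a K.
Proof.
move=> h0 hc [H [e [phi [psi [he hemb hH [S [hL hS]]]]]]].
have inj := embeds_inj h0.
have bij : bijective phi0.
  by apply: (inj_card_bij inj); apply: eq_leq; exact: esym hc.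
exists H, e, (phi \o phi0), (psi0 \o psi); rewrite hc; split=> //.
  by move=> x y /=; rewrite hemb h0.
exists (fun x => S (phi0 x)); split; first exact: rank_le_restrict phi0 id _ _ hL.
case: hS => h1 h2; split=> // y; apply: le_trans (h2 y).
by rewrite [X in _ <= X](reindex phi0) //; exact: onW_bij.
Qed.

Section Product.
Variables (H1 H2 : finZmodType) (e1 : H1 -> H1 -> C) (e2 : H2 -> H2 -> C).
Definition bichar_pair (x z : H1 * H2) : C := e1 x.1 z.1 * e2 x.2 z.2.

Lemma bichar_pairP : bichar e1 -> bichar e2 -> bichar bichar_pair.
Proof.
move=> [d1 n1 s1] [d2 n2 s2]; split=> [x y z|x z|x]; rewrite /bichar_pair.
- by rewrite /= d1 d2 mulrACA.
- by rewrite Normc.normcM n1 n2 mulr1.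
- rewrite -(pair_bigA _ (fun a b => e1 x.1 a * e2 x.2 b)) /=.
  under eq_bigr do rewrite -mulr_sumr.
  rewrite -mulr_suml s1 s2 card_prod natrM mulrACA; case: x => a b /=.
  have -> : ((a, b) == 0 :> H1 * H2) = (a == 0) && (b == 0) by [].
  by rewrite -mulnb natrM.
Qed.

Lemma dft_pair x z : dft bichar_pair x z = dft e1 x.1 z.1 * dft e2 x.2 z.2.
Proof.
by rewrite /dft /bichar_pair card_prod natrM sqrtrM ?ler0n // rmorphM invfM mulrACA.
Qed.
End Product.

(* If one of the two groups is too small for its power saving to be seen by A x B, its
   whole transform is put into S, which is cheap for the same reason. *)
Lemma tame_pair (A B : finZmodType) (eta a K : R) :
  0 < eta -> eta <= 1 / 2 -> 0 < a -> 1 <= K -> tame A eta a K -> tame B eta a K ->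
  tame (A * B)%type (2 * eta) (a * eta) (2 * K ^+ 2).
Proof.
move=> eta0 eta1 a0 K1.
move=> [H1 [e1 [phi1 [psi1 [he1 hm1 hH1 [S1 [hL1 hS1]]]]]]].
move=> [H2 [e2 [phi2 [psi2 [he2 hm2 hH2 [S2 [hL2 hS2]]]]]]].
exists (H1 * H2)%type, (bichar_pair e1 e2), (fun x => (phi1 x.1, phi2 x.2)),
  (fun z => (psi1 z.1, psi2 z.2)).
have n1 := card_zmod_ge1 A; have n2 := card_zmod_ge1 B.
rewrite !card_prod !natrM; set n : R := #|A|%:R in n1 hH1 hL1 hS1 *.
set m : R := #|B|%:R in n2 hH2 hL2 hS2 *.
have n0 : 0 < n by apply: lt_le_trans n1.
have m0 : 0 < m by apply: lt_le_trans n2.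
have K0 : 0 <= K by apply: le_trans K1.
have N1 : 1 <= n * m by rewrite mulr_ege1.
have N0 : 0 < n * m by apply: lt_le_trans N1.
have K2 : K * K <= 2 * K ^+ 2 by rewrite -expr2 ler_peMl ?exprn_ge0 // ler1n.
have Ksq : K <= K ^+ 2 by rewrite expr2 ler_peMl.
have K20 : 0 <= K ^+ 2 by rewrite exprn_ge0.
split.
- exact: bichar_pairP.
- by move=> x y /=; rewrite hm1 hm2; case: x y => [? ?] [? ?].
- apply: le_trans (ler_pM _ _ hH1 hH2) _; rewrite ?ler0n // mulrACA -powRM ?(ltW n0) ?(ltW m0) //.
  apply: ler_pM => //; rewrite ?mulr_ge0 ?powR_ge0 // ler_powR //; lra.
- have hrank (D : (A * B)%type -> (H1 * H2)%type -> C) r s :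
    (forall x z, D x z = dft e1 (phi1 x.1) z.1 * dft e2 (phi2 x.2) z.2) ->
    splits D r s ->
    splits (fun x z => dft (bichar_pair e1 e2) (phi1 x.1, phi2 x.2) z) r s.
    move=> hD [S [hL hS]]; exists S; split=> //.
    by apply: rank_le_ext hL => x z; rewrite dft_pair hD.
  (* Here y is the factor whose rank is saved and x the one of full rank: y >= (x y)^eta turns the
     saving y^(-a) into (x y)^(-a eta). *)
  have hr (x y : R) : 1 <= x -> 1 <= y -> (x * y) `^ eta <= y ->
      x * (K * y `^ (1 - a)) <= K * (x * y) `^ (1 - a * eta).
    move=> x1 y1 hy; have x0 : 0 < x by apply: lt_le_trans x1.
    have y0 : 0 < y by apply: lt_le_trans y1.
    have xy0 : 0 < x * y by rewrite mulr_gt0.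
    rewrite mulrCA ler_wpM2l // !powR_add // !powRr1 ?(ltW y0) ?(ltW xy0) // mulrA.
    rewrite ler_wpM2l ?(ltW xy0) // !powRN lef_pV2 ?posrE ?powR_gt0 //.
    rewrite (mulrC a) powRrM; apply: ge0_ler_powR; rewrite ?nnegrE ?powR_ge0 // ltW //.
  (* Here x is a small factor, embedded in a group of order h: its trivial bound satisfies sqrt h <=
     K x <= K (x y)^eta. *)
  have hs (x y h : R) : 1 <= x -> 1 <= y -> 0 <= h ->
      h <= K * x `^ (1 + eta) -> x <= (x * y) `^ eta ->
      Num.sqrt h * (K * y `^ eta) <= 2 * K ^+ 2 * (x * y) `^ (2 * eta).
    move=> x1 y1 h0 hh hx; have x0 : 0 < x by apply: lt_le_trans x1.
    have y0 : 0 < y by apply: lt_le_trans y1.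
    have xy0 : 0 < x * y by rewrite mulr_gt0.
    have hq : Num.sqrt h <= K * x.
      rewrite -[leRHS]ger0_norm ?mulr_ge0 ?(ltW x0) // -sqrtr_sqr ler_wsqrtr //.
      apply: le_trans hh _; rewrite exprMn; apply: ler_pM; rewrite ?powR_ge0 //.
      by rewrite -powR_mulrn ?(ltW x0) // ler_powR //; lra.
    apply: le_trans (_ : (K * (x * y) `^ eta) * (K * (x * y) `^ eta) <= _).
      apply: ler_pM; rewrite ?sqrtr_ge0 ?mulr_ge0 ?powR_ge0 //.
        by apply: le_trans hq _; rewrite ler_wpM2l.
      rewrite ler_wpM2l //; apply: ge0_ler_powR; rewrite ?nnegrE ?(ltW eta0) ?(ltW y0) ?(ltW xy0) //.
      by rewrite ler_peMl // ltW.
    rewrite mulrACA -powR_add // -mulr2n -[eta *+ 2]mulr_natl.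
    by rewrite ler_wpM2r ?powR_ge0.
  have hK : K * (n * m) `^ (1 - a * eta) <= 2 * K ^+ 2 * (n * m) `^ (1 - a * eta).
    by rewrite ler_wpM2r ?powR_ge0 // (le_trans Ksq) // ler_peMl // ler1n.
  have l1 := l1_le_inj (embeds_inj hm1) (dft_trivial_bound he1).
  have l2 := l1_le_inj (embeds_inj hm2) (dft_trivial_bound he2).
  have cmn : m * n = n * m by rewrite mulrC.
  have [hn|hn] := leP n ((n * m) `^ eta).
    (* Since eta <= 1/2, the two factors are not both below (n m)^eta unless they equal it. *)
    have hm : (n * m) `^ eta <= m.
      rewrite -(ler_pM2l n0); apply: le_trans (_ : (n * m) `^ (1 / 2) * (n * m) `^ (1 / 2) <= _).
        apply: ler_pM; rewrite ?powR_ge0 ?(ltW n0) //; last by rewrite ler_powR.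
        by apply: le_trans hn _; rewrite ler_powR.
      rewrite -powR_add //; have -> : 1 / 2 + 1 / 2 = 1 :> R by field.
      by rewrite powRr1 ?(ltW N0).
    apply: (@hrank (fun x z => dft e1 (phi1 x.1) z.1 * dft e2 (phi2 x.2) z.2)) => //.
    exists (fun x z => dft e1 (phi1 x.1) z.1 * S2 x.2 z.2); split.
      apply: rank_leW (rank_le_ext _
        (rank_le_pair (rank_le_row (fun x z => dft e1 (phi1 x) z)) hL2)).
        by apply: le_trans hK; apply: hr.
      by move=> x z /=; rewrite mulrBr.
    apply: l1_leW (l1_le_pair (sqrtr_ge0 _) l1 hS2).
    exact: hs.
  have [hm|hm] := leP m ((n * m) `^ eta).
    apply: (@hrank (fun x z => dft e1 (phi1 x.1) z.1 * dft e2 (phi2 x.2) z.2)) => //.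
    exists (fun x z => S1 x.1 z.1 * dft e2 (phi2 x.2) z.2); split.
      apply: rank_leW (rank_le_ext _
        (rank_le_pair hL1 (rank_le_row (fun x z => dft e2 (phi2 x) z)))).
        apply: le_trans hK; rewrite mulrC -cmn; apply: hr => //.
        by rewrite cmn ltW.
      by move=> x z /=; rewrite mulrBl.
    apply: l1_leW (l1_le_pair _ hS1 l2).
      by rewrite mulrC -cmn; apply: hs; rewrite ?cmn.
    by rewrite mulr_ge0 ?powR_ge0.
  apply: (@hrank (fun x z => dft e1 (phi1 x.1) z.1 * dft e2 (phi2 x.2) z.2)) => //.
  exists (fun x z => S1 x.1 z.1 * S2 x.2 z.2); split.
    (* U1 U2 - S1 S2 = (U1 - S1) U2 + S1 (U2 - S2). *)
    have r1 := rank_le_pair hL1 (rank_le_row (fun x z => dft e2 (phi2 x) z)).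
    have r2 := rank_le_pair (rank_le_row S1) hL2.
    apply: rank_leW (rank_le_ext _ (rank_leD r1 r2)).
      set Z := (n * m) `^ (1 - a * eta); have -> : 2 * K ^+ 2 * Z = K ^+ 2 * Z + K ^+ 2 * Z by ring.
      apply: lerD.
        apply: le_trans (_ : K * (n * m) `^ (1 - a * eta) <= _).
          by rewrite mulrC -cmn; apply: hr => //; rewrite cmn ltW.
        by rewrite ler_wpM2r ?powR_ge0.
      apply: le_trans (_ : K * (n * m) `^ (1 - a * eta) <= _).
        by apply: hr => //; rewrite ltW.
      by rewrite ler_wpM2r ?powR_ge0.
    move=> x z /=; ring.
  apply: l1_leW (l1_le_pair _ hS1 hS2); last by rewrite mulr_ge0 ?powR_ge0.
  rewrite mulrACA -powRM ?(ltW n0) ?(ltW m0) // -expr2.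
  apply: ler_pM; rewrite ?exprn_ge0 ?powR_ge0 //.
  by rewrite ler_powR //; lra.
Qed.

Lemma tame_class_pair (P Q : finZmodType -> Prop) (eta : R) :
  0 < eta -> eta <= 1 / 2 -> tame_class P eta -> tame_class Q eta ->
  tame_class (fun G => exists A B : finZmodType,
    [/\ P A, Q B & G = (A * B)%type :> finZmodType]) (2 * eta).
Proof.
move=> eta0 eta1 [a [K [a0 K1 hP]]] [b [L [b0 L1 hQ]]].
pose c := Num.min a b; pose M := Num.max K L.
have c0 : 0 < c by rewrite lt_min a0.
have M1 : 1 <= M by rewrite le_max K1.
exists (c * eta), (2 * M ^+ 2); split.
- by rewrite mulr_gt0.
- by rewrite (le_trans (exprn_ege1 2 M1)) // ler_peMl ?exprn_ge0 ?ler1n // (le_trans ler01).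
- move=> G [A [B [hA hB ->]]]; apply: tame_pair => //.
    by apply: tame_le (hP A hA); rewrite ?ge_min ?le_max ?lexx // (le_trans ler01).
  by apply: tame_le (hQ B hB); rewrite ?ge_min ?le_max ?lexx ?orbT // (le_trans ler01).
Qed.

Lemma tame_class_embed (P Q : finZmodType -> Prop) (eta : R) :
  tame_class Q eta ->
  (forall G, P G -> exists (G' : finZmodType) (phi : G -> G') (psi : G' -> G),
     [/\ Q G', embeds phi psi & #|G| = #|G'|]) ->
  tame_class P eta.
Proof.
move=> [a [K [a0 K1 hQ]]] h; exists a, K; split=> // G /h [G' [phi [psi [hG' he hc]]]].
exact: tame_embed he hc (hQ _ hG').
Qed.

Lemma tame_class_le (P : finZmodType -> Prop) (eta eta' : R) :
  eta <= eta' -> tame_class P eta -> tame_class P eta'.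
Proof.
move=> h [a [K [a0 K1 hP]]]; exists a, K; split=> // G /hP.
by apply: tame_le => //; apply: le_trans K1.
Qed.

End Tame.

(** * Tensor powers *)

Section Power.
Variable R : realType.
Local Notation C := R[i].

Definition weight (I : finType) (b : {ffun I -> bool}) : nat := (\sum_i b i)%N.

(** Markov's inequality for the exponential moment, the sum of w^(weight g) over all g being (w a +
    b)^|I|. The condition on P serves both tails: large weights with w >= 1, small weights with w <=
    1. *)
Lemma weight_markov (I : finType) (P : pred {ffun I -> bool}) (a b w : R) t :
  0 <= a -> 0 <= b -> 0 < w ->
  (forall g, P g -> w ^+ t <= w ^+ weight g) ->
  \sum_(g | P g) \prod_i (if g i then a else b) <= (w * a + b) ^+ #|I| / w ^+ t.
Proof.
move=> a0 b0 w0 hP; rewrite ler_pdivlMr ?exprn_gt0 //.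
have -> : (w * a + b) ^+ #|I| = \sum_(g : {ffun I -> bool}) \prod_i (if g i then w * a else b).
  rewrite -(bigA_distr_bigA (fun (_ : I) (g : bool) => if g then w * a else b)).
  by under eq_bigr do rewrite big_bool; rewrite prodr_const.
have hpos (g : {ffun I -> bool}) : 0 <= \prod_i (if g i then a else b).
  by apply: prodr_ge0 => i _; case: (g i).
have hw (g : {ffun I -> bool}) : \prod_i (if g i then w * a else b) =
    w ^+ weight g * \prod_i (if g i then a else b).
  rewrite /weight expr_sum -big_split /=; apply: eq_bigr => i _.
  by case: (g i); rewrite ?expr1 ?expr0 ?mul1r.
rewrite mulr_suml [leLHS]big_mkcond; apply: ler_sum => g _; rewrite hw.
case: ifP => [/hP h|_]; first by rewrite mulrC ler_wpM2r.
by rewrite mulr_ge0 // exprn_ge0 // ltW.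
Qed.

(* L collects the products with at least t factors u - S; both parts are estimated by
   Markov's inequality for the number of such factors. *)
Lemma splits_power (I X Y : finType) (u : X -> Y -> C) (c s l : R) t :
  0 < c -> c <= 1 -> 1 <= s -> 0 <= l ->
  splits u (c * #|X|%:R) s -> l1_le u l ->
  splits (fun (x : {ffun I -> X}) (y : {ffun I -> Y}) => \prod_i u (x i) (y i))
    ((2 * #|X|%:R) ^+ #|I| * c ^+ t) ((2 * s) ^+ #|I| * ((l + s) / s) ^+ t).
Proof.
move=> c0 c1 s1 l0 [S [hL hS]] hu.
have s0 : 0 < s by apply: lt_le_trans s1.
pose K (b : bool) x y := if b then u x y - S x y else S x y.
pose Kf (g : {ffun I -> bool}) (x : {ffun I -> X}) (y : {ffun I -> Y}) :=
  \prod_i K (g i) (x i) (y i).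
exists (fun x y => \sum_(g | (weight g < t)%N) Kf g x y); split.
  have hr b : rank_le (K b) (if b then c * #|X|%:R else #|X|%:R).
    by case: b => //; exact: rank_le_row.
  have := rank_le_sum (P := fun g : {ffun I -> bool} => (t <= weight g)%N)
    (fun g _ => rank_le_ffun g hr).
  move=> H; apply: rank_leW (rank_le_ext _ H).
    (* The parameter is chosen to make w a = b; likewise s / (l + s) for the row and column sums
       below. *)
    apply: le_trans (weight_markov (w := c^-1) (t := t) _ _ _ _) _.
    - by rewrite mulr_ge0 ?ler0n // ltW.
    - by rewrite ler0n.
    - by rewrite invr_gt0.
    - by move=> g hg; rewrite ler_weXn2l // invf_ge1.
    - rewrite mulrA mulVf ?gt_eqF // mul1r -exprVn invrK.
      by have -> : #|X|%:R + #|X|%:R = 2 * #|X|%:R :> R by ring.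
  move=> x y; rewrite -/(Kf _ x y).
  have -> : \prod_i u (x i) (y i) = \sum_g Kf g x y.
    rewrite -(bigA_distr_bigA (fun i b => K b (x i) (y i))).
    by apply: eq_bigr => i _; rewrite big_bool /= subrK.
  rewrite [X in _ = X - _](bigID (fun g => (weight g < t)%N)) /= [X in _ = X - _]addrC addrK.
  by apply: eq_bigl => g; rewrite -leqNgt.
have hl b : l1_le (K b) (if b then l + s else s).
  case: b => //; have := l1_leZ (-1) hS; rewrite normc_opp Normc.normc1 mul1r => hS'.
  by apply: l1_le_ext (l1_leD hu hS') => x y; rewrite mulN1r.
have H := l1_le_sum (P := fun g : {ffun I -> bool} => (weight g < t)%N)
  (fun g _ => l1_le_ffun (fun i => hl (g i))).
apply: l1_leW H.
have ls0 : 0 < l + s by rewrite ltr_wpDl.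
apply: le_trans (weight_markov (w := s / (l + s)) (t := t) _ _ _ _) _.
- exact: ltW.
- exact: ltW.
- by rewrite divr_gt0.
- move=> g /ltnW hg; rewrite ler_wiXn2l ?divr_ge0 ?(ltW s0) ?(ltW ls0) //.
  by rewrite ler_pdivrMr // mul1r lerDr.
- rewrite divfK ?gt_eqF // -exprVn invf_div.
  by have -> : s + s = 2 * s by ring.
Qed.

Section FfunBichar.
Variables (I : finType) (H : finZmodType) (e : H -> H -> C).
Definition bichar_ffun (x z : {ffun I -> H}) : C := \prod_i e (x i) (z i).

Lemma bichar_ffunP : bichar e -> bichar bichar_ffun.
Proof.
move=> [d n s]; split=> [x y z|x z|x]; rewrite /bichar_ffun.
- by rewrite -big_split; apply: eq_bigr => i _; rewrite ffunE d.
- by rewrite normc_prod big1.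
- rewrite -(bigA_distr_bigA (fun i z => e (x i) z)) /=.
  under eq_bigr do rewrite s.
  rewrite big_split /= prodr_const card_ffun natrX; congr (_ * _).
  have [->|nz] := eqVneq x 0; first by rewrite big1 // => i _; rewrite ffunE eqxx.
  have [i hi] : exists i, x i != 0.
    apply/existsP; apply: contraNT nz; rewrite negb_exists => /forallP h.
    by apply/eqP/ffunP => i; rewrite ffunE; apply/eqP; move: (h i); rewrite negbK.
  by rewrite (bigD1 i) //= (negbTE hi) mul0r.
Qed.

Lemma dft_ffun x z : dft bichar_ffun x z = \prod_i dft e (x i) (z i).
Proof.
rewrite /dft big_split /= prodr_const; congr (_ * _).
have -> : Num.sqrt (#|{ffun I -> H}|%:R : R) = Num.sqrt #|H|%:R ^+ #|I|.
  rewrite card_ffun natrX.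
  by elim: #|I| => [|k IH]; rewrite ?expr0 ?sqrtr1 // !exprS sqrtrM ?ler0n // IH.
by rewrite rmorphXn exprVn.
Qed.
End FfunBichar.

(** The block whose tensor powers are taken. X is only a set, in order to allow a digit set {0, ...,
    m - 1}; the factor 3 grows to 3^k in the k-th power and is harmless once #|X|^eps is large. *)
Definition good_block (eps c : R) (m0 : nat) (X : finType) (H : finZmodType)
    (e : H -> H -> C) (theta : X -> H) :=
  [/\ bichar e, injective theta, (m0 <= #|X|)%N, (#|H| <= 3 * #|X|)%N &
      splits (fun x z => dft e (theta x) z) (c * #|X|%:R) (#|H|%:R `^ eps)].

(** Elements of G are written as words over X, and the letterwise differences in H determine the
    difference in G. *)
Definition box (X : finType) (H : finZmodType) (theta : X -> H)
    (G : finZmodType) (I : finType) :=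
  exists (d : G -> {ffun I -> X}) (psi : {ffun I -> H} -> G),
    embeds (fun x => [ffun i => theta (d x i)]) psi.

(** Take the k-th tensor power, k = |I|, with at least eps k low-rank factors in L. With m = |X| the
    rank is at most (2 m)^k c^(eps k) <= (m / 4)^k, and m^k <= D 2^k |G| leaves D |G| 2^(-k), a
    power saving because |G| <= m^k. *)
Lemma tame_box (eps c : R) (m0 D : nat) (X : finType) (H : finZmodType)
    (e : H -> H -> C) (theta : X -> H) :
  0 < eps -> eps <= 1 -> 0 < c -> c <= 1 -> c `^ eps <= 8^-1 ->
  (4 <= m0)%N -> 6 <= m0%:R `^ eps -> (0 < D)%N -> good_block eps c m0 e theta ->
  tame_class (fun G => exists2 I : finType, box theta G I &
    (#|X| ^ #|I| <= D * 2 ^ #|I| * #|G|)%N) (16 * eps).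
Proof.
move=> eps0 eps1 c0 c1 hc m4 hm0 D0 [he hinj hm hM hsp].
set m := #|X| in hm hM hsp *; set M := #|H| in hM hsp *.
have mM : (m <= M)%N by exact: leq_card hinj.
have m1 : (4 <= m)%N by apply: leq_trans hm.
have mR0 : 0 < (m%:R : R) by rewrite ltr0n (leq_trans _ m1).
have MR1 : 1 <= (M%:R : R) by rewrite ler1n (leq_trans _ mM) // (leq_trans _ m1).
have MR0 : 0 < (M%:R : R) by apply: lt_le_trans MR1.
have h6 : 6 <= m%:R `^ eps.
  by apply: le_trans hm0 _; apply: ge0_ler_powR; rewrite ?nnegrE ?ler0n ?ler_nat // ltW.
(* Chosen so that m^a = 2, whence 2^(-k) = (m^k)^(-a) <= n^(-a). *)
pose a := ln 2 / ln (m%:R : R).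
have lnm : 0 < ln (m%:R : R) by rewrite ln_gt0 // ltr1n (leq_trans _ m1).
have a0 : 0 < a by rewrite divr_gt0 // ln_gt0 // ltr1n.
have ma : m%:R `^ a = 2.
  by rewrite /powR gt_eqF // /a divfK ?gt_eqF // lnK // posrE ltr0n.
have D1 : 1 <= (D%:R : R) by rewrite ler1n.
exists a, (2 * M%:R * D%:R ^+ 16); split=> //.
  by apply: mulr_ege1; [apply: mulr_ege1 => //; rewrite ler1n | exact: exprn_ege1].
move=> G [I [d [psi hemb]] hcard].
pose k := #|I|; rewrite -/k in hcard.
set n := #|G| in hcard *.
have dinj : injective d.
  have inj := embeds_inj hemb.
  by move=> x y xy; apply: inj; rewrite xy.
have nm : (n <= m ^ k)%N by rewrite -card_ffun; exact: leq_card dinj.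
have n1 : 1 <= (n%:R : R) := card_zmod_ge1 R G.
(* Square the hypothesis on m^k and cancel 4^k <= m^k. *)
have hmk : (m ^ k <= D ^ 2 * n ^ 2)%N.
  have h4 : (4 ^ k <= m ^ k)%N by case: (k) => [|j] //; rewrite leq_exp2r.
  have : (m ^ k * m ^ k <= D ^ 2 * n ^ 2 * m ^ k)%N.
    apply: leq_trans (leq_mul hcard hcard) _.
    apply: leq_trans (_ : D ^ 2 * n ^ 2 * 4 ^ k <= _)%N; last by rewrite leq_mul2l h4 orbT.
    by apply: eq_leq; rewrite (expnMn 2 2 k) -!mulnn mulnACA (mulnACA D) mulnAC.
  by rewrite leq_pmul2r // expn_gt0 (leq_trans _ m1).
have mnR : (m%:R : R) ^+ k <= D%:R ^+ 2 * n%:R ^+ 2.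
  by rewrite -!natrX -natrM ler_nat.
have n0 : 0 < (n%:R : R) by apply: lt_le_trans n1.
have hn2 : 2^-1 ^+ k <= n%:R `^ (- a) :> R.
  rewrite powRN exprVn lef_pV2 ?posrE ?exprn_gt0 ?powR_gt0 //.
  rewrite -ma -powR_mulrn ?powR_ge0 // -powRrM mulrC (powRrM _ k%:R) powR_mulrn ?ler0n //.
  by apply: ge0_ler_powR; rewrite ?nnegrE ?exprn_ge0 ?ler0n ?(ltW a0) // -natrX ler_nat.
(* Factors exponential in k are measured by powers of y: y^k is at most D^2 n^(2 eps), and no more
   than y^(6 k) is spent below. *)
pose y : R := m%:R `^ eps.
have y6 : 6 <= y by [].
have y0 : 0 < y by apply: lt_le_trans y6.
have y1 : 1 <= y by apply: le_trans y6; rewrite ler1n.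
have ypow j : (m%:R ^+ j) `^ eps = y ^+ j.
  by rewrite -powR_mulrn ?ler0n // -powRrM mulrC powRrM powR_mulrn ?powR_ge0.
have DR0 : 0 <= (D%:R : R) by rewrite ler0n.
have hy : y ^+ k <= D%:R ^+ 2 * n%:R `^ (2 * eps).
  rewrite -ypow; apply: le_trans (_ : (D%:R ^+ 2 * n%:R ^+ 2) `^ eps <= _).
    by apply: ge0_ler_powR; rewrite ?nnegrE ?mulr_ge0 ?exprn_ge0 ?ler0n ?(ltW eps0) ?(ltW mR0).
  rewrite powRM ?exprn_ge0 ?ler0n // (powRrM _ 2) powR_mulrn ?ler0n //.
  by rewrite ler_wpM2r ?powR_ge0 // ler1_powR // exprn_ege1.
have hmkn : (m%:R : R) ^+ k <= D%:R * 2 ^+ k * n%:R by rewrite -!natrX -!natrM ler_nat.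
have K16 j : (j <= 16)%N -> (D%:R : R) ^+ j <= 2 * M%:R * D%:R ^+ 16.
  move=> hj; apply: le_trans (_ : D%:R ^+ 16 <= _).
    by rewrite ler_weXn2l.
  by rewrite ler_peMl ?exprn_ge0 // mulr_ege1 // ler1n.
(* From t >= eps k comes c^t <= 8^(-k); from t <= eps k + 1, a single extra factor 2 M, which is a
   constant of the block. *)
pose t := (Num.truncn (eps * k%:R)).+1.
exists {ffun I -> H}, (bichar_ffun e), (fun x => [ffun i => theta (d x i)]), psi.
split=> //; first exact: bichar_ffunP.
  rewrite card_ffun -/M -/k -/n natrX.
  apply: le_trans (_ : D%:R ^+ 3 * n%:R `^ (1 + 2 * eps) <= _); last first.
    by apply: ler_pM; rewrite ?powR_ge0 ?exprn_ge0 ?K16 // ler_powR //; lra.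
  apply: le_trans (_ : (3 * m%:R) ^+ k <= _).
    by apply: lerXn2r; rewrite ?nnegrE ?mulr_ge0 ?ler0n // -natrM ler_nat.
  rewrite exprMn; apply: le_trans (_ : 3 ^+ k * (D%:R * 2 ^+ k * n%:R) <= _).
    by rewrite ler_wpM2l // exprn_ge0.
  have -> : 3 ^+ k * (D%:R * 2 ^+ k * n%:R) = 6 ^+ k * (D%:R * n%:R) :> R.
    have -> : 6 = 3 * 2 :> R by ring.
    by rewrite exprMn; ring.
  rewrite powR_add // powRr1 ?ler0n //.
  have -> : D%:R ^+ 3 * (n%:R * n%:R `^ (2 * eps)) =
     (D%:R ^+ 2 * n%:R `^ (2 * eps)) * (D%:R * n%:R) by ring.
  rewrite ler_wpM2r ?mulr_ge0 ?ler0n //; apply: le_trans hy.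
  by apply: lerXn2r; rewrite ?nnegrE ?(ltW y0).
set s := M%:R `^ eps in hsp *.
have s1 : 1 <= s by rewrite -[1](powRr0 (M%:R)) ler_powR // ltW.
have s0 : 0 < s by apply: lt_le_trans s1.
have l0 : 0 <= Num.sqrt (M%:R : R) := sqrtr_ge0 _.
have hu := l1_le_inj hinj (dft_trivial_bound he).
have [S [hL hS]] :=
  @splits_power I X H (fun x z => dft e (theta x) z) c s _ t c0 c1 s1 l0 hsp hu.
exists (fun x z => S (d x) z); split.
  apply: rank_leW (rank_le_ext _ (rank_le_restrict d id hL)); last first.
    by move=> x z; rewrite dft_ffun; under [in RHS]eq_bigr do rewrite ffunE.
  rewrite -/m -/k -/n exprMn.
  have ct : c ^+ t <= 8^-1 ^+ k.
    rewrite -[c ^+ t]powR_mulrn ?(ltW c0) //.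
    apply: le_trans (_ : c `^ (eps * k%:R) <= _).
      by apply: ger_powR; [rewrite c0 | rewrite ltW // truncnS_gt].
    by rewrite powRrM powR_mulrn ?powR_ge0 //; apply: lerXn2r; rewrite ?nnegrE ?powR_ge0 ?invr_ge0.
  apply: le_trans (_ : 2 ^+ k * (D%:R * 2 ^+ k * n%:R) * 8^-1 ^+ k <= _).
    apply: ler_pM; rewrite ?mulr_ge0 ?exprn_ge0 ?ler0n ?(ltW c0) //.
    by rewrite ler_wpM2l // exprn_ge0.
  have -> : 2 ^+ k * (D%:R * 2 ^+ k * n%:R) * 8^-1 ^+ k = D%:R * (n%:R * 2^-1 ^+ k) :> R.
    have -> : 2^-1 = 2 * 2 * 8^-1 :> R by field.
    by rewrite !exprMn; ring.
  rewrite powR_add // powRr1 ?ler0n //.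
  apply: ler_pM; rewrite ?mulr_ge0 ?exprn_ge0 ?invr_ge0 ?ler0n //.
    exact: (K16 1%N).
  by rewrite ler_wpM2l ?ler0n.
apply: l1_leW (l1_le_inj dinj hS).
rewrite -/k -/n.
have hMm : (M%:R : R) <= 3 * m%:R by rewrite -natrM ler_nat.
have m4R : 4 <= (m%:R : R) by rewrite ler_nat.
have hs : 2 * s <= y ^+ 3.
  rewrite exprS; apply: ler_pM; rewrite ?(ltW s0) //; first by apply: le_trans y6; rewrite ler_nat.
  rewrite -ypow; apply: ge0_ler_powR; rewrite ?nnegrE ?exprn_ge0 ?(ltW eps0) ?ler0n //.
  by nra.
have sM : s <= M%:R by rewrite ler1_powR.
have lM : Num.sqrt M%:R <= M%:R :> R.
  rewrite -[leRHS]ger0_norm ?ler0n // -sqrtr_sqr ler_wsqrtr // expr2 ler_peMl ?ler0n //.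
have ls : (Num.sqrt M%:R + s) / s <= 2 * M%:R.
  rewrite ler_pdivrMr //; apply: le_trans (_ : 2 * M%:R <= _); first by lra.
  by rewrite ler_peMr ?mulr_ge0 ?ler0n.
have M1 : 1 <= 2 * M%:R :> R by rewrite mulr_ege1 // ler1n.
have ht : ((Num.sqrt M%:R + s) / s) ^+ t <= 2 * M%:R * y ^+ (3 * k).
  apply: le_trans (_ : (2 * M%:R) ^+ t <= _).
    by apply: lerXn2r; rewrite ?nnegrE ?mulr_ge0 ?ler0n ?invr_ge0 ?addr_ge0 ?(ltW s0).
  rewrite /t exprS ler_wpM2l ?mulr_ge0 ?ler0n //.
  rewrite -[leLHS]powR_mulrn ?mulr_ge0 ?ler0n //.
  apply: le_trans (_ : (2 * M%:R) `^ (eps * k%:R) <= _).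
    by rewrite ler_powR // truncn_le // mulr_ge0 ?ler0n ?ltW.
  rewrite powRrM powR_mulrn ?powR_ge0 // exprM.
  apply: lerXn2r; rewrite ?nnegrE ?powR_ge0 ?exprn_ge0 ?(ltW y0) //.
  rewrite -ypow; apply: ge0_ler_powR; rewrite ?nnegrE ?mulr_ge0 ?exprn_ge0 ?(ltW eps0) ?ler0n //.
  rewrite exprS expr2; nra.
apply: le_trans (_ : y ^+ (3 * k) * (2 * M%:R * y ^+ (3 * k)) <= _).
  apply: ler_pM => //.
  - by rewrite exprn_ge0 // mulr_ge0 // ltW.
  - by rewrite exprn_ge0 // divr_ge0 ?addr_ge0 ?(ltW s0).
  by rewrite exprM; apply: lerXn2r; rewrite ?nnegrE ?mulr_ge0 ?ler0n ?exprn_ge0 ?(ltW s0) ?(ltW y0).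
have -> : y ^+ (3 * k) * (2 * M%:R * y ^+ (3 * k)) = 2 * M%:R * (y ^+ k) ^+ 6.
  have h6k : (k * 6 = 3 * k + 3 * k)%N by rewrite -mulnDl mulnC.
  by rewrite mulrCA -exprD -exprM h6k.
rewrite -[leRHS]mulrA ler_wpM2l ?mulr_ge0 ?ler0n //.
apply: le_trans (_ : (D%:R ^+ 2 * n%:R `^ (2 * eps)) ^+ 6 <= _).
  by rewrite ler_pXn2r ?nnegrE ?mulr_ge0 ?exprn_ge0 ?powR_ge0 ?(ltW y0).
rewrite exprMn -exprM; apply: ler_pM; rewrite ?exprn_ge0 ?powR_ge0 //.
  by rewrite ler_weXn2l.
rewrite -powR_mulrn ?powR_ge0 // -powRrM ler_powR //.
lra.
Qed.

End Power.

(** * The logarithm of a unitary of order four *)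

Section Spectral.
Variable R : realType.
Local Notation C := R[i].

(** Functional calculus: when q is inverse to p, pointwise operations on the eigenvalues a become
    operations on kernels. *)
Definition conj_diag (X : finType) (p q : X -> X -> C) (a : X -> C) (x y : X) : C :=
  \sum_l p x l * a l * q l y.

(* U = p 'i^w q with q the inverse of p; the "logarithm" p w q of U is cheap, and w,
   seen as a random variable, has mean mu and variance at most V. *)
Definition spectral (X : finType) (U : X -> X -> C) (mu V B : R) (m : nat) :=
  exists (w : X -> nat) (p q : X -> X -> C),
    [/\ (forall l l', \sum_x q l x * p x l' = (l == l')%:R) /\
        (forall x y, conj_diag p q (fun _ => 1) x y = (x == y)%:R),
        forall x y, U x y = conj_diag p q (fun l => 'i ^+ w l) x y,
        l1_le (conj_diag p q (fun l => (w l)%:R)) B,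
        \sum_l ((w l)%:R - mu) = 0 /\ \sum_l ((w l)%:R - mu) ^+ 2 <= V * #|X|%:R &
        0 <= mu <= m%:R].

Lemma conj_diagM (X : finType) (p q : X -> X -> C) (a b : X -> C) x y :
  (forall l l', \sum_x q l x * p x l' = (l == l')%:R) ->
  \sum_z conj_diag p q a x z * conj_diag p q b z y =
  conj_diag p q (fun l => a l * b l) x y.
Proof.
move=> h; rewrite /conj_diag.
under eq_bigr do rewrite big_distrlr /=.
rewrite exchange_big /=; apply: eq_bigr => l _.
rewrite exchange_big /=.
have re (x1 x2 x3 x4 x5 x6 : C) :
  x1 * x2 * x3 * (x4 * x5 * x6) = x3 * x4 * (x1 * x2 * (x5 * x6)) by ring.
under eq_bigr => l' _ do under eq_bigr => z _ do rewrite re.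
under eq_bigr => l' _ do rewrite -mulr_suml h.
rewrite (bigD1 l) //= eqxx mul1r big1 ?addr0 ?mulrA // => l' ne.
by rewrite eq_sym (negbTE ne) mul0r.
Qed.

Lemma conj_diagD (X : finType) (p q : X -> X -> C) (a b : X -> C) x y :
  conj_diag p q (fun l => a l + b l) x y = conj_diag p q a x y + conj_diag p q b x y.
Proof.
by rewrite /conj_diag -big_split; apply: eq_bigr => l _; rewrite mulrDr mulrDl.
Qed.

Lemma conj_diagZ (X : finType) (p q : X -> X -> C) (c : C) (a : X -> C) x y :
  conj_diag p q (fun l => c * a l) x y = c * conj_diag p q a x y.
Proof. by rewrite /conj_diag big_distrr /=; apply: eq_bigr => l _; ring. Qed.

Lemma conj_diag_sum (X I : finType) (p q : X -> X -> C) (a : I -> X -> C) x y :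
  conj_diag p q (fun l => \sum_i a i l) x y = \sum_i conj_diag p q (a i) x y.
Proof.
rewrite /conj_diag exchange_big; apply: eq_bigr => l _.
by rewrite big_distrr big_distrl.
Qed.

(** The logarithm of a tensor product is W (x) 1 + 1 (x) W', so the costs add. Its eigenvalues are
    sums of two independent variables: means add, and so do variances, the cross term being
    centered. *)
Lemma spectral_pair (X X' : finType) (U : X -> X -> C) (U' : X' -> X' -> C)
    (mu V B mu' V' B' : R) m m' :
  0 <= B -> 0 <= B' -> spectral U mu V B m -> spectral U' mu' V' B' m' ->
  spectral (fun x y : X * X' => U x.1 y.1 * U' x.2 y.2)
    (mu + mu') (V + V') (B + B') (m + m').
Proof.
move=> B0 B0' [w [p [q [[qp pq] hU hW [hm hv] /andP[mu0 mum]]]]].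
move=> [w' [p' [q' [[qp' pq'] hU' hW' [hm' hv'] /andP[mu0' mum']]]]].
pose pp (x l : X * X') := p x.1 l.1 * p' x.2 l.2.
pose qq (x l : X * X') := q x.1 l.1 * q' x.2 l.2.
have hpair (a : X -> C) (a' : X' -> C) x y :
    conj_diag pp qq (fun l => a l.1 * a' l.2) x y =
    conj_diag p q a x.1 y.1 * conj_diag p' q' a' x.2 y.2.
  rewrite /conj_diag big_distrlr pair_big /=; apply: eq_bigr => l _.
  by rewrite /pp /qq; ring.
exists (fun l => w l.1 + w' l.2)%N, pp, qq; split.
- split=> [l l'|x y].
    rewrite -(pair_bigA _ (fun a b => qq l (a, b) * pp (a, b) l')) /=.
    under eq_bigr => a _ do under eq_bigr => b _ do rewrite /qq /pp /= mulrACA.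
    under eq_bigr do rewrite -mulr_sumr.
    by rewrite -mulr_suml qp qp' -natrM mulnb -xpair_eqE -!surjective_pairing.
  have := hpair (fun _ => 1) (fun _ => 1) x y; rewrite pq pq' -natrM mulnb.
  rewrite -xpair_eqE -!surjective_pairing => <-.
  by apply: eq_bigr => l _; rewrite !mulr1.
- move=> x y; rewrite hU hU' -hpair; apply: eq_bigr => l _.
  by rewrite exprD.
- have H := l1_leD (l1_le_pair B0 hW (@l1_le_id R X'))
    (l1_le_pair ler01 (@l1_le_id R X) hW').
  rewrite mulr1 mul1r in H; apply: l1_le_ext H => x y.
  rewrite /= -pq -pq' -!hpair -conj_diagD.
  by apply: eq_bigr => l _; rewrite natrD mulr1 mul1r.
- have hc : #|{: X * X'}|%:R = #|X|%:R * #|X'|%:R :> R by rewrite card_prod natrM.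
  have dec (l : X * X') : (w l.1 + w' l.2)%N%:R - (mu + mu') =
      ((w l.1)%:R - mu) + ((w' l.2)%:R - mu') by rewrite natrD opprD addrACA.
  split.
    under eq_bigr do rewrite dec.
    rewrite -(pair_bigA _ (fun a b => ((w a)%:R - mu) + ((w' b)%:R - mu'))) /=.
    under eq_bigr do rewrite big_split /= hm' addr0 sumr_const.
    by rewrite sumrMnl hm mul0rn.
  have sq (a : R) : \sum_b (a + ((w' b)%:R - mu')) ^+ 2 =
      #|X'|%:R * a ^+ 2 + \sum_b ((w' b)%:R - mu') ^+ 2.
    have re (b : R) : (a + b) ^+ 2 = a ^+ 2 + (2 * a) * b + b ^+ 2 by ring.
    have z : \sum_b 2 * a * ((w' b)%:R - mu') = 0 by rewrite -mulr_sumr hm' mulr0.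
    under eq_bigr do rewrite re.
    by rewrite big_split big_split /= z addr0 sumr_const mulr_natl.
  under eq_bigr do rewrite dec.
  rewrite -(pair_bigA _ (fun a b => (((w a)%:R - mu) + ((w' b)%:R - mu')) ^+ 2)) /=.
  under eq_bigr do rewrite sq.
  rewrite big_split /= -(mulr_sumr _ _ _ #|X'|%:R) sumr_const -[X in _ + X]mulr_natl hc.
  have -> : (V + V') * (#|X|%:R * #|X'|%:R) =
    #|X'|%:R * (V * #|X|%:R) + #|X|%:R * (V' * #|X'|%:R) by ring.
  by rewrite lerD // ler_wpM2l.
- by rewrite addr_ge0 // natrD lerD.
Qed.

Lemma falling_binomial (d j : nat) :
  \prod_(i < j) ((d%:R - i%:R) / i.+1%:R) = 'C(d, j)%:R :> C.
Proof.
elim: j => [|j IH]; first by rewrite big_ord0 bin0.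
rewrite big_ord_recr IH /=.
have nz : (j.+1%:R : C) != 0 by rewrite pnatr_eq0.
apply: (mulIf nz); rewrite -natrM mulnC mul_bin_left mulrA divfK // natrM mulrC.
have [h|h] := leqP j d; first by rewrite natrB.
by rewrite bin_small // !mulr0.
Qed.

(** With z = 'i - 1 this is the Newton series of 'i^d; its terms with j > d vanish, so one degree J
    serves all d <= J. *)
Lemma binomial_trunc (z : C) (d J : nat) : (d <= J)%N ->
  \sum_(j < J.+1) z ^+ j * 'C(d, j)%:R = (1 + z) ^+ d.
Proof.
move=> hd; rewrite exprDn.
rewrite -(big_mkord xpredT (fun j => z ^+ j * 'C(d, j)%:R)).
rewrite -(big_mkord xpredT (fun j => 1 ^+ (d - j) * z ^+ j *+ 'C(d, j))).
rewrite (big_cat_nat (n := d.+1)) ?ltnS //= [X in _ + X]big_nat_cond.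
rewrite [X in _ + X]big1 => [|j /andP[/andP[hj _] _]]; last by rewrite bin_small ?mulr0.
by rewrite addr0; apply: eq_bigr => j _; rewrite expr1n mul1r mulr_natr.
Qed.

Lemma normc_i_sub1 : normc ('i - 1 : C) <= 2.
Proof.
apply: le_trans (ler_normcD _ _) _.
by rewrite normc_i normc_opp Normc.normc1 -natr1.
Qed.

(* S is the Newton interpolation of w |-> 'i^w on the 2t + 2 integers from
   w0 = floor mu - t on; Chebyshev bounds the number of the remaining values of w. *)
Lemma spectral_splits (X : finType) (U : X -> X -> C) (mu V B : R) (m t : nat) :
  0 <= B -> (0 < t)%N -> spectral U mu V B m ->
  splits U (V * #|X|%:R / t%:R ^+ 2)
    ((2 * (B + m%:R + (2 * t).+1%:R)) ^+ (2 * t).+2).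
Proof.
move=> B0 t0 [w [p [q [[qp pq] hU hW [hm hv] /andP[mu0 mum]]]]].
(* The truncated subtraction starts the window at 0 when t exceeds floor mu; no eigenvalue is lost,
   as all are nonnegative. *)
pose J := (2 * t).+1; pose w0 := (Num.truncn mu - t)%N.
pose Y := B + m%:R + J%:R.
have Y0 : 0 <= Y by rewrite !addr_ge0.
have w0m : (w0 <= m)%N.
  apply: leq_trans (leq_subr _ _) _; rewrite -(ler_nat R).
  by apply: le_trans mum; rewrite truncn_le.
(* [s j] is the binomial polynomial of w - w0 over j, a product of affine functions of w, each with
   kernel of cost at most Y; [g] is the truncated Newton series of 'i^w. *)
pose f (i : nat) (l : X) : C := ((w l)%:R - (w0%:R + i%:R)) / i.+1%:R.
pose s (j : nat) (l : X) : C := \prod_(i < j) f i l.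
pose g (l : X) : C := 'i ^+ w0 * \sum_(j < J.+1) ('i - 1) ^+ j * s j l.
have hf i : (i <= J)%N -> l1_le (conj_diag p q (f i)) Y.
  move=> hi.
  have := l1_leZ (i.+1%:R)^-1 (l1_leD hW (l1_leZ (- (w0%:R + i%:R)) (@l1_le_id R X))).
  move=> H; apply: l1_leW (l1_le_ext _ H).
    rewrite mulr1 Normc.normcV normc_nat normc_opp -natrD normc_nat.
    apply: le_trans (_ : 1 * (B + (w0 + i)%:R) <= _).
      rewrite ler_wpM2r ?addr_ge0 // invf_le1 // ler1n //.
    by rewrite mul1r /Y -addrA lerD2l -natrD ler_nat leq_add.
  move=> x y /=; rewrite -pq -conj_diagZ -conj_diagD -conj_diagZ.
  by apply: eq_bigr => l _; rewrite /f mulr1 [_^-1 * _]mulrC.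
have hs j : (j <= J)%N -> l1_le (conj_diag p q (s j)) (Y ^+ j).
  elim: j => [|j IH] hj.
    apply: l1_le_ext (@l1_le_id R X) => x y; rewrite -pq.
    by apply: eq_bigr => l _; rewrite /s big_ord0.
  have hj' : (j <= J)%N by apply: ltnW.
  rewrite exprSr; apply: l1_le_ext (l1_le_comp _ Y0 (IH hj') (hf _ hj')); last by rewrite exprn_ge0.
  move=> x y /=; rewrite conj_diagM //; apply: eq_bigr => l _.
  by rewrite /s big_ord_recr.
exists (conj_diag p q g); split; last first.
  have H : l1_le (fun x y => 'i ^+ w0 * \sum_(j < J.+1) (('i - 1) ^+ j * conj_diag p q (s j) x y))
     (1 * \sum_(j < J.+1) (2 * Y) ^+ j).
    have e1 : normc ('i ^+ w0 : C) = 1 by rewrite normcX normc_i expr1n.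
    rewrite -[X in X * _]e1; apply: l1_leZ; apply: l1_le_sum => j _.
    have hj : (j <= J)%N by rewrite -ltnS.
    apply: l1_leW (l1_leZ _ (hs j hj)).
    rewrite exprMn ler_wpM2r ?exprn_ge0 // normcX.
    by apply: lerXn2r; rewrite ?nnegrE ?normc_ge0 ?ler0n ?normc_i_sub1.
  apply: l1_leW (l1_le_ext _ H).
    rewrite mul1r -/J -/Y exprS.
    have Y1 : 1 <= 2 * Y.
      rewrite mulr_ege1 ?ler1n // /Y (le_trans _ (_ : J%:R <= _)) ?ler1n //.
      by rewrite lerDr addr_ge0.
    apply: le_trans (_ : \sum_(j < J.+1) (2 * Y) ^+ J <= _).
      by apply: ler_sum => j _; rewrite ler_weXn2l // -ltnS.
    rewrite sumr_const card_ord -[leLHS]mulr_natl ler_wpM2r ?exprn_ge0 ?mulr_ge0 //.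
    apply: le_trans (_ : 2 * J%:R <= _).
      by rewrite -natrM ler_nat /J; lia.
    by rewrite ler_wpM2l // lerDr addr_ge0.
  move=> x y /=; rewrite /g conj_diagZ; congr (_ * _).
  by rewrite conj_diag_sum; apply: eq_bigr => j _; rewrite conj_diagZ.
(* The series is exact on the window, and outside it w differs from mu by at least t; U - S lives on
   the bad eigenvectors. *)
pose bad := [pred l | 'i ^+ w l != g l].
have hbad : #|bad|%:R <= V * #|X|%:R / t%:R ^+ 2.
  rewrite ler_pdivlMr ?exprn_gt0 ?ltr0n //; apply: le_trans hv.
  rewrite mulrC mulr_natr -sumr_const big_mkcond; apply: ler_sum => l _.
  case: ifP => [|_]; last by rewrite sqr_ge0.
  rewrite inE => hl; rewrite -[leRHS]real_normK ?num_real //.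
  apply: lerXn2r; rewrite ?nnegrE ?ler0n //.
  have h1 : (Num.truncn mu)%:R <= mu by rewrite truncn_le.
  have h2 := truncnS_gt mu; have tR : 0 <= t%:R :> R by rewrite ler0n.
  have [hw|hw] := ltnP (w l) w0.
    have : (w l + t <= Num.truncn mu)%N by rewrite /w0 in hw; lia.
    rewrite -(ler_nat R) natrD => h3.
    by rewrite ler0_norm; lra.
  have [hw'|hw'] := ltnP (w0 + J) (w l).
    have : ((Num.truncn mu).+1 + t <= w l)%N by rewrite /w0 /J in hw'; lia.
    rewrite -(ler_nat R) natrD => h3.
    by rewrite ger0_norm; lra.
  case/negP: hl; rewrite /g.
  have -> : \sum_(j < J.+1) ('i - 1) ^+ j * s j l = 'i ^+ (w l - w0) :> C.
    have hd : (w l - w0 <= J)%N by rewrite leq_subLR.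
    transitivity ((1 + ('i - 1) : C) ^+ (w l - w0)); last by rewrite addrC subrK.
    rewrite -(binomial_trunc _ hd).
    apply: eq_bigr => j _; congr (_ * _); rewrite -falling_binomial.
    by apply: eq_bigr => i _; rewrite /f (natrB _ hw) opprD addrA.
  by rewrite -exprD subnKC.
apply: rank_leW hbad (rank_le_ext _ (rank_le_index bad
   (fun x l => p x l) (fun l y => ('i ^+ w l - g l) * q l y))).
move=> x y /=; rewrite hU /conj_diag -sumrB big_mkcond /=; apply: eq_bigr => l _.
case: ifP => [_|/negbFE/eqP ->]; first by ring.
by rewrite subrr.
Qed.

End Spectral.

(** * Finite cyclic groups and their products *)

Section Cyclic.
Variable R : realType.
Local Notation C := R[i].

Lemma prim_root_exists n : exists z : C, n.+1.-primitive_root z.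
Proof.
pose p : {poly C} := 'X^(n.+1) - 1; have [r Dp] := closed_field_poly_normal p.
rewrite (monicP _) ?monicXnsubC // scale1r in Dp.
have rn1 : all n.+1.-unity_root r by apply/allP=> z; rewrite -root_prod_XsubC -Dp.
have sz_r : (n.+1 < (size r).+1)%N.
  by rewrite -(size_prod_XsubC r id) -Dp size_XnsubC.
have [|z] := hasP (has_prim_root (ltn0Sn n) rn1 _ sz_r); last by exists z.
by rewrite -separable_prod_XsubC -Dp separable_Xn_sub_1 // pnatr_eq0.
Qed.

Definition zeta n : C := xchoose (prim_root_exists n).

Lemma zetaP n : n.+1.-primitive_root (zeta n).
Proof. exact: xchooseP. Qed.

Definition bichar_cyc n (x y : 'I_n.+1) : C := zeta n ^+ (x * y).

Lemma bichar_cycP n : bichar (@bichar_cyc n).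
Proof.
have zN := prim_expr_order (zetaP n).
split=> [x y z|x z|x]; rewrite /bichar_cyc.
- rewrite ![(_ * z)%N]mulnC !(exprM _ z) -exprD /= expr_mod //.
  by rewrite -exprM mulnC exprM zN expr1n.
- rewrite normcX.
  have : normc (zeta n) ^+ n.+1 == 1 by rewrite -normcX zN Normc.normc1.
  by rewrite pexpr_eq1 ?normc_ge0 // => /eqP ->; rewrite expr1n.
- under eq_bigr do rewrite exprM.
  have [->|nz] := eqVneq x 0.
    under eq_bigr do rewrite expr0 expr1n.
    by rewrite mul1r sumr_const.
  rewrite mul0r; have := subrX1 (zeta n ^+ x) n.+1.
  rewrite -exprM mulnC exprM zN expr1n subrr => /esym/eqP.
  rewrite mulf_eq0 subr_eq0 -(prim_order_dvd (zetaP n)) => /orP[|/eqP //].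
  move=> /dvdn_leq h; have x0 : (0 < x)%N by rewrite lt0n.
  by have := h x0; rewrite leqNgt ltn_ord.
Qed.

Lemma bichar_cycC n (x y : 'I_n.+1) : bichar_cyc x y = bichar_cyc y x.
Proof. by rewrite /bichar_cyc mulnC. Qed.

(** The square of the Fourier transform is the reflection x |-> - x, so its fourth power is the
    identity. *)
Lemma dft_cyc_sqr n (x y : 'I_n.+1) :
  \sum_z dft (@bichar_cyc n) x z * dft (@bichar_cyc n) z y = (x + y == 0)%:R.
Proof.
have [hD _ hs] := bichar_cycP n.
rewrite /dft.
under eq_bigr => z _ do rewrite mulrACA -invfM sqrt_card_sqr (bichar_cycC z y) -hD.
rewrite -mulr_suml hs mulfK // pnatr_eq0 -lt0n.
exact: (card_zmod_gt0 'I_n.+1).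
Qed.

Lemma fourth_root (x : C) : x ^+ 4 = 1 -> exists2 w, (w < 4)%N & x = 'i ^+ w.
Proof.
move=> /eqP; rewrite -subr_eq0.
have i2 : 'i ^+ 2 = -1 :> C by rewrite sqrCi.
have -> : x ^+ 4 - 1 = (x - 1) * (x + 1) * ((x - 'i) * (x + 'i)).
  have -> : (x - 'i) * (x + 'i) = x ^+ 2 - 'i ^+ 2 by ring.
  by rewrite i2; ring.
rewrite !mulf_eq0 !subr_eq0 !addr_eq0 => /orP[/orP[]|/orP[]] /eqP ->.
- by exists 0%N.
- by exists 2%N.
- by exists 1%N.
- by exists 3%N => //; rewrite exprS i2 mulrN1.
Qed.

(* The cubic polynomial taking the value w at 'i^w for w = 0, 1, 2, 3. *)
Lemma quarter_interpolation (j : C) w : j * j = -1 -> (w < 4)%N ->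
  w%:R = 3 / 2 + ((j - 1) / 2 * j ^+ w + (- 2^-1 * (j ^+ w * j ^+ w) +
         - (j + 1) / 2 * (j ^+ w * (j ^+ w * j ^+ w)))) :> C.
Proof.
move=> j2; have nz : (2 : C) != 0 by rewrite pnatr_eq0.
case: w => [|[|[|[|//]]]] _.
- by rewrite expr0; field.
- rewrite expr1.
  transitivity (1 + (j * j + 1) * ((1 - j - j * j) / 2)); last by field.
  by rewrite j2 addNr mul0r addr0.
- by rewrite expr2 j2; field.
- rewrite exprS expr2 j2 mulrN1.
  transitivity (3 + (j * j + 1) * ((j * j + j - 3) / 2)); last by field.
  by rewrite j2 addNr mul0r addr0.
Qed.

(** The minimal polynomial divides X^4 - 1, which has distinct roots: the transform is
    diagonalizable with powers of 'i as eigenvalues. *)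
Lemma dft_cyc_diag n : exists (w : 'I_n.+1 -> nat) (p q : 'I_n.+1 -> 'I_n.+1 -> C),
  [/\ forall l, (w l < 4)%N,
      (forall l l', \sum_x q l x * p x l' = (l == l')%:R) /\
      (forall x y, conj_diag p q (fun _ => 1) x y = (x == y)%:R) &
      forall x y, dft (@bichar_cyc n) x y = conj_diag p q (fun l => 'i ^+ w l) x y].
Proof.
pose A : 'M[C]_n.+1 := \matrix_(x, y) dft (@bichar_cyc n) x y.
have A2 x y : (A *m A) x y = (x + y == 0)%:R.
  by rewrite mxE -dft_cyc_sqr; apply: eq_bigr => z _; rewrite !mxE.
have A4 : A ^+ 4 = 1.
  rewrite (exprM A 2 2) [A ^+ 2]expr2 expr2.
  apply/matrixP => x y; rewrite mxE (bigD1 (- x)) //= [A * A]/(A *m A) !A2.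
  rewrite subrr eqxx mul1r big1 => [|z ne]; last first.
    by rewrite A2 addrC addr_eq0 (negbTE ne) mul0r.
  by rewrite addr0 mxE addrC subr_eq0 eq_sym.
have /diagonalizableP : exists2 rs : seq C, uniq rs &
    mxminpoly A %| \prod_(x <- rs) ('X - x%:P).
    have [z zP] := prim_root_exists 3.
    have hu : uniq [seq z ^+ i | i <- index_iota 0 4].
      rewrite map_inj_in_uniq ?iota_uniq // => i j; rewrite !mem_index_iota => hi hj.
      by move/eqP; rewrite (eq_prim_root_expr zP) !modn_small // => /eqP.
    exists [seq z ^+ i | i <- index_iota 0 4] => //.
    apply: mxminpoly_min.
  by rewrite big_map (factor_Xn_sub_1 zP) rmorphB rmorphXn /= horner_mx_X A4 rmorph1 subrr.
case=> P Pu /diagonalizable_forPex[D] /(simmxP Pu) hD.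
have hDk k l j : (P *m A ^+ k) l j = D 0 l ^+ k * P l j.
  elim: k j => [|k IH] j; first by rewrite expr0 mulmx1 mul1r.
  rewrite exprSr [A ^+ k * A]/(A ^+ k *m A) mulmxA mxE.
  under eq_bigr do rewrite IH -mulrA.
  rewrite -mulr_sumr exprSr -mulrA; congr (_ * _).
  by have := congr1 (fun M : 'M_n.+1 => M l j) hD; rewrite mul_diag_mx !mxE.
(* The rows of P are eigenvectors; an eigenvalue with another fourth power would force a zero row in
   an invertible matrix. *)
have D4 l : D 0 l ^+ 4 = 1.
  apply/eqP; rewrite -subr_eq0; apply: contraT => nz.
  have h0 j : P l j = 0.
    have := hDk 4 l j; rewrite A4 mulmx1 => /esym/eqP.
    by rewrite -subr_eq0 -{2}[P l j]mul1r -mulrBl mulf_eq0 (negbTE nz) => /eqP.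
  have := congr1 (fun M : 'M_n.+1 => M l l) (mulmxV Pu).
  rewrite !mxE eqxx big1 => [/eqP|j _]; first by rewrite eq_sym oner_eq0.
  by rewrite h0 mul0r.
have hw l : exists w, (w < 4)%N && (D 0 l == 'i ^+ w).
  by have [w w4 ->] := fourth_root (D4 l); exists w; rewrite w4 eqxx.
exists (fun l => xchoose (hw l)), (fun x l => invmx P x l), (fun l y => P l y).
have hw1 l : (xchoose (hw l) < 4)%N /\ D 0 l = 'i ^+ xchoose (hw l).
  by have /andP[h1 /eqP h2] := xchooseP (hw l); split.
split=> [l||]; first by case: (hw1 l).
- split=> [l l'|x y].
    have := mulmxV Pu => /matrixP/(_ l l'); rewrite !mxE => <-; exact: eq_bigr.
  have := mulVmx Pu => /matrixP/(_ x y); rewrite !mxE => <-.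
  by apply: eq_bigr => l _; rewrite mulr1.
- move=> x y; have -> : dft (@bichar_cyc n) x y = A x y by rewrite mxE.
  have -> : A = invmx P *m (diag_mx D *m P) by rewrite -hD mulKmx.
  rewrite mxE; apply: eq_bigr => l _.
  by rewrite -(hw1 l).2 mul_diag_mx mxE mulrA.
Qed.

(** W is a cubic polynomial in U, and the powers U^i have row and column sums at most N^i, with N
    the order; as W takes values in [0, 3], its variance is at most 9. *)
Lemma spectral_cyc n : exists mu : R,
  spectral (dft (@bichar_cyc n)) mu 9 (4 * n.+1%:R ^+ 3) 3.
Proof.
have [w [p [q [hw [qp pq] hU]]]] := dft_cyc_diag n.
pose N : R := n.+1%:R; have N1 : 1 <= N by rewrite ler1n.
pose mu : R := (\sum_l (w l)%:R) / N.
have N0 : 0 < N by apply: lt_le_trans N1.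
have hc : #|'I_n.+1|%:R = N by rewrite card_ord.
have w3 l : (w l)%:R <= 3 :> R by rewrite ler_nat -ltnS.
have mu0 : 0 <= mu by rewrite divr_ge0 ?sumr_ge0 ?ltW.
have mu3 : mu <= 3.
  rewrite ler_pdivrMr //; apply: le_trans (ler_sum _ (fun l _ => w3 l)) _.
  by rewrite sumr_const card_ord mulr_natr.
exists mu, w, p, q; split=> //; last by rewrite mu0.
  have hU1 : l1_le (dft (@bichar_cyc n)) N.
    apply: l1_leW (dft_trivial_bound (bichar_cycP n)); rewrite hc.
    by rewrite -[leRHS]ger0_norm ?(ltW N0) // -sqrtr_sqr ler_wsqrtr // expr2 ler_peMl // ltW.
  have N0' := ltW N0.
  have hU2 := l1_le_comp N0' N0' hU1 hU1.
  have hU3 := l1_le_comp N0' (mulr_ge0 N0' N0') hU1 hU2.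
  have H := l1_leD (l1_leZ (3 / 2) (@l1_le_id R 'I_n.+1))
    (l1_leD (l1_leZ (('i - 1) / 2) hU1)
       (l1_leD (l1_leZ (- 2^-1) hU2) (l1_leZ (- ('i + 1) / 2) hU3))).
  apply: l1_leW (l1_le_ext _ H).
    have h2 : normc (2^-1 : C) = 2^-1 by rewrite Normc.normcV normc_nat.
    have c0 : normc (3 / 2 : C) = 3 / 2 by rewrite Normc.normcM h2 normc_nat.
    have c1 : normc (('i - 1) / 2 : C) <= 1.
      by rewrite Normc.normcM h2 ler_pdivrMr // mul1r normc_i_sub1.
    have c3 : normc (- ('i + 1) / 2 : C) <= 1.
      rewrite Normc.normcM h2 ler_pdivrMr // mul1r normc_opp.
      by apply: le_trans (ler_normcD _ _) _; rewrite normc_i Normc.normc1.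
    have NN : N <= N * N by rewrite ler_peMl.
    have NNN : N * N <= N * (N * N) by rewrite ler_wpM2l.
    rewrite c0 normc_opp h2 -/N.
    have d1 : normc (('i - 1) / 2 : C) * N <= N by rewrite ler_piMl.
    have d3 : normc (- ('i + 1) / 2 : C) * (N * (N * N)) <= N * (N * N).
      by rewrite ler_piMl // !mulr_ge0.
    have -> : 4 * N ^+ 3 = 4 * (N * (N * N)) by ring.
    lra.
  move=> x y /=; rewrite -pq.
  under [X in (- 2^-1) * X]eq_bigr do rewrite !hU.
  under [X in (- ('i + 1) / 2) * X]eq_bigr => z _.
    rewrite hU; under eq_bigr do rewrite !hU; rewrite conj_diagM //; over.
  rewrite !conj_diagM // hU -!conj_diagZ -!conj_diagD.
  apply: eq_bigr => l _; rewrite mulr1; congr (_ * _ * _).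
  by apply/esym/quarter_interpolation => //; rewrite -expr2 sqrCi.
split.
  by rewrite sumrB sumr_const card_ord /mu -mulr_natr divfK ?gt_eqF // subrr.
apply: le_trans (_ : \sum_(l < n.+1) (9 : R) <= _).
  apply: ler_sum => l _; have := w3 l; have : 0 <= (w l)%:R :> R by rewrite ler0n.
  move=> h1 h2; have -> : 9 = 3 ^+ 2 :> R by ring.
  rewrite -[leLHS]real_normK ?num_real //; apply: lerXn2r; rewrite ?nnegrE //.
  by rewrite ler_norml; lra.
by rewrite sumr_const mulr_natr.
Qed.

(* The entry n stands for the cyclic group of order n + 1. *)
Fixpoint prodZ (ns : seq nat) : finZmodType :=
  if ns is n :: ns' then ('I_n.+1 * prodZ ns')%type else 'I_1.

Fixpoint bichar_prodZ (ns : seq nat) : prodZ ns -> prodZ ns -> C :=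
  if ns is n :: ns' then bichar_pair (@bichar_cyc n) (@bichar_prodZ ns')
  else @bichar_cyc 0.

Lemma bichar_prodZP ns : bichar (@bichar_prodZ ns).
Proof.
elim: ns => [|n ns IH]; first exact: bichar_cycP.
exact: bichar_pairP (bichar_cycP n) IH.
Qed.

Lemma card_prodZ ns : #|prodZ ns| = (\prod_(n <- ns) n.+1)%N.
Proof.
elim: ns => [|n ns IH]; first by rewrite big_nil card_ord.
by rewrite big_cons card_prod card_ord IH.
Qed.

(** The trivial group that ends [prodZ] counts as one more factor, hence [(size ns).+1] and the
    summand 1. *)
Lemma spectral_prodZ ns : exists mu : R,
  spectral (dft (@bichar_prodZ ns)) mu (9 * (size ns).+1%:R)
    (4 * (1 + \sum_(n <- ns) n.+1%:R ^+ 3)) (3 * (size ns).+1).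
Proof.
elim: ns => [|n ns [mu' IH]].
  have [mu h] := spectral_cyc 0; exists mu.
  by move: h; rewrite expr1n /= big_nil addr0 !mulr1 muln1.
have [mu h] := spectral_cyc n; exists (mu + mu').
have -> : 9 * (size (n :: ns)).+1%:R = 9 + 9 * (size ns).+1%:R :> R.
  by rewrite /= -[(size ns).+2%:R]natr1; ring.
have -> : 4 * (1 + \sum_(j <- n :: ns) j.+1%:R ^+ 3) =
    4 * n.+1%:R ^+ 3 + 4 * (1 + \sum_(j <- ns) j.+1%:R ^+ 3) :> R.
  by rewrite big_cons; ring.
have -> : (3 * (size (n :: ns)).+1 = 3 + 3 * (size ns).+1)%N by rewrite mulnS.
have B1 : 0 <= 4 * n.+1%:R ^+ 3 :> R by rewrite mulr_ge0 ?exprn_ge0.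
have B2 : 0 <= 4 * (1 + \sum_(j <- ns) j.+1%:R ^+ 3) :> R.
  by rewrite mulr_ge0 // addr_ge0 // sumr_ge0 // => j _; rewrite exprn_ge0.
have [w [p [q [h1 h2 h3 h4 h5]]]] := spectral_pair B1 B2 h IH.
by exists w, p, q; split=> // x y; rewrite -h2 dft_pair.
Qed.

End Cyclic.

(** * Splitting the transform of a product of many cyclic groups *)

Section Blocks.
Variable R : realType.
Local Notation C := R[i].

Lemma leq_prodn_const (T : nat) (ns : seq nat) :
  all (fun n => (T <= n.+1)%N) ns -> (T ^ size ns <= \prod_(n <- ns) n.+1)%N.
Proof.
elim: ns => [|n ns IH] /=; first by rewrite big_nil.
by move=> /andP[h /IH h2]; rewrite big_cons expnS leq_mul.
Qed.

(** For j^4 factors the standard deviation is of order j^2, so a window of half-width t = K j^2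
    suffices. Interpolation costs T^(O(j)) to the power O(t), that is T^(O(K j^3)), whereas the
    group has order at least T^(j^4). *)
Lemma prodZ_splits (eps c : R) : 0 < eps -> 0 < c ->
  exists j0 : nat, forall j T Q ns, (j0 <= j)%N -> size ns = (j ^ 4)%N -> (2 <= T)%N ->
    all (fun n => (T <= n.+1 <= Q)%N) ns -> (34 * j ^ 4 * Q ^ 3 <= T ^ (16 + 4 * j))%N ->
    splits (dft (@bichar_prodZ R ns)) (c * #|prodZ ns|%:R) (#|prodZ ns|%:R `^ eps).
Proof.
move=> eps0 c0.
have arith (s ab a u : nat) : (s <= ab -> u <= a -> 1 <= a -> a <= ab ->
  2 * (4 * s.+1 + 3 * a.+1 + (2 * u).+1) <= 34 * ab)%N by lia.
have arith1 (a u : nat) : (0 < a -> 0 < u -> 16 + 4 * a <= 20 * a /\ (2 * u).+2 <= 4 * u)%N.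
  by lia.
have arith2 (a b s : nat) : (20 * a * (4 * (b * s)) = 80 * b * (a * s))%N by ring.
(* Chebyshev leaves a proportion 9 (j^4 + 1) / (K j^2)^2 <= 18 / K^2 <= c. *)
pose K := (Num.truncn (18 / c)).+1.
have hK : 18 / c <= K%:R by apply/ltW/truncnS_gt.
(* The second bound gives 80 K j^3 <= eps j^4, which compares the cost with the order of the
   group. *)
pose j0 := maxn K (Num.truncn (80 * K%:R / eps)).+1.
exists j0 => j T Q ns; rewrite geq_max => /andP[Kj epsj] hsz T2 hns hY.
have hj : 80 * K%:R <= eps * j%:R.
  rewrite -ler_pdivrMl // mulrC; apply: le_trans (ltW (truncnS_gt _)) _.
  by rewrite ler_nat.
have K1 : (0 < K)%N by [].
have j1 : (0 < j)%N by apply: leq_trans Kj.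
have [mu hsp] := spectral_prodZ R ns.
pose t := (K * j ^ 2)%N.
have t0 : (0 < t)%N by rewrite muln_gt0 expn_gt0 j1.
have hpos : 0 <= 4 * (1 + \sum_(n <- ns) n.+1%:R ^+ 3) :> R.
  by rewrite mulr_ge0 // addr_ge0 // sumr_ge0 // => i _; rewrite exprn_ge0.
have [S [hL hS]] := spectral_splits hpos t0 hsp.
exists S; split.
  apply: rank_leW hL; rewrite hsz mulrAC ler_wpM2r // ler_pdivrMr ?exprn_gt0 ?ltr0n //.
  rewrite -natrX /t expnMn -expnM natrM mulrA.
  have h18 : 18 <= c * K%:R ^+ 2.
    apply: le_trans (_ : c * K%:R <= _); first by rewrite -ler_pdivrMl // mulrC.
    by rewrite ler_wpM2l ?(ltW c0) // expr2 ler_peMl // ler1n.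
  apply: le_trans (_ : 18 * (j ^ 4)%:R <= _).
    by rewrite -!natrM ler_nat; have : (0 < j ^ 4)%N; [rewrite expn_gt0 j1 | lia].
  rewrite (natrX R K 2) (_ : (2 * 2)%N = 4%N) // ler_wpM2r //.
have hq : (\sum_(n <- ns) n.+1 ^ 3 <= j ^ 4 * Q ^ 3)%N.
  rewrite -hsz; elim: (ns) hns => [|n s IH] /=; first by rewrite big_nil.
  move=> /andP[/andP[_ hn] /IH h]; rewrite big_cons mulSn leq_add // leq_exp2r //.
apply: l1_leW hS.
have Q1 : (1 <= Q ^ 3)%N.
  move: hns; rewrite expn_gt0 orbF; case: (ns) hsz => [/eqP|n s _ /= /andP[/andP[_ h] _]].
    by rewrite eq_sym expn_eq0 /= -leqn0 leqNgt j1.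
  by apply: leq_trans h.
have hbase : 2 * (4 * (1 + \sum_(n <- ns) n.+1%:R ^+ 3) + (3 * (size ns).+1)%:R + (2 * t).+1%:R)
    <= T%:R ^+ (16 + 4 * j) :> R.
  apply: le_trans (_ : (34 * j ^ 4 * Q ^ 3)%:R <= _); last by rewrite -natrX ler_nat.
  have -> : \sum_(n <- ns) n.+1%:R ^+ 3 = (\sum_(n <- ns) n.+1 ^ 3)%N%:R :> R.
    by rewrite natr_sum; apply: eq_bigr => n _; rewrite natrX.
  rewrite nat1r -!natrM -!natrD -natrM ler_nat hsz.
  have ta : (t <= j ^ 4)%N.
    rewrite /t -[(j ^ 4)%N]/(j ^ (2 + 2))%N expnD leq_mul2r; apply/orP; right.
    by apply: leq_trans Kj _; rewrite -mulnn leq_pmulr.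
  have a1 : (1 <= j ^ 4)%N by rewrite expn_gt0 j1.
  have ab : (j ^ 4 <= j ^ 4 * Q ^ 3)%N by rewrite leq_pmulr.
  by rewrite -mulnA; apply: arith hq ta a1 ab.
apply: le_trans (_ : (T%:R ^+ (16 + 4 * j)) ^+ (2 * t).+2 <= _).
  apply: lerXn2r => //; rewrite nnegrE ?exprn_ge0 // mulr_ge0 // !addr_ge0 //.
rewrite -exprM -powR_mulrn //.
have T1 : 1 <= (T%:R : R) by rewrite ler1n ltnW.
apply: le_trans (_ : T%:R `^ ((j ^ 4)%:R * eps) <= _).
  rewrite ler_powR //.
  apply: le_trans (_ : (80 * K * j ^ 3)%:R <= _).
    rewrite ler_nat; apply: leq_trans (_ : (20 * j) * (4 * t) <= _)%N.
      by have [h1 h2] := arith1 _ _ j1 t0; apply: leq_mul.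
    by rewrite /t arith2 -expnS.
  rewrite (natrM _ (80 * K)) [leRHS]mulrC (natrX _ j 4) (natrX _ j 3) (exprS _ 3) [leRHS]mulrA.
  by rewrite ler_wpM2r ?exprn_ge0 // natrM.
rewrite powRrM powR_mulrn //; apply: ge0_ler_powR; rewrite ?nnegrE ?exprn_ge0 ?(ltW eps0) //.
rewrite -natrX ler_nat card_prodZ -hsz; apply: leq_prodn_const.
by apply: sub_all hns => n /andP[].
Qed.

End Blocks.

(** * Digit expansions *)

Section Boxes.
Variable R : realType.
Local Notation C := R[i].

Lemma embeds_trans (G H K : finZmodType) (f : G -> H) (f' : H -> G)
    (g : H -> K) (g' : K -> H) :
  embeds f f' -> embeds g g' -> embeds (g \o f) (f' \o g').
Proof. by move=> h1 h2 x y /=; rewrite h2 h1. Qed.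

Lemma box_embed (X : finType) (H : finZmodType) (theta : X -> H) (G G' : finZmodType)
    (I : finType) (f : G -> G') (f' : G' -> G) :
  embeds f f' -> box theta G' I -> box theta G I.
Proof.
move=> h [d [psi hd]]; exists (d \o f), (f' \o psi).
exact: (embeds_trans h hd).
Qed.

Lemma box_pair (X : finType) (H : finZmodType) (theta : X -> H) (G1 G2 : finZmodType)
    (I1 I2 : finType) :
  box theta G1 I1 -> box theta G2 I2 -> box theta (G1 * G2)%type (I1 + I2)%type.
Proof.
move=> [d1 [psi1 h1]] [d2 [psi2 h2]].
exists (fun x => [ffun i => match i with inl i => d1 x.1 i | inr i => d2 x.2 i end]),
  (fun h => (psi1 [ffun i => h (inl i)], psi2 [ffun i => h (inr i)])).
move=> x y /=; case: x y => [x1 x2] [y1 y2].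
have -> : (x1, x2) - (y1, y2) = (x1 - y1, x2 - y2) by [].
by rewrite -h1 -h2; congr (psi1 _, psi2 _); apply/ffunP => i; rewrite !ffunE.
Qed.

Lemma Zp_gen_mulrn n (x : nat) : (inZp 1 : 'I_n.+1) *+ x = inZp x.
Proof. by rewrite Zp_mulrn; apply: val_inj => /=; rewrite modnMml mul1n. Qed.

(** Carries do not matter: x - y is the sum of the digit differences times m^i in the cyclic group,
    and [hdiff] lets each digit difference be read off in H. *)
Lemma box_cyc m (H : finZmodType) (theta : 'I_m -> H) n k :
  (forall a b a' b' : 'I_m, theta a - theta b = theta a' - theta b' -> (a + b' = a' + b)%N) ->
  (0 < m)%N -> (n < m ^ k)%N -> box theta 'I_n.+1 'I_k.
Proof.
move=> hdiff m0 nmk.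
pose g : 'I_n.+1 := inZp 1.
(* The value 0 is a default off the set of differences of digits. *)
pose tau (h : H) : 'I_n.+1 :=
  if [pick ab : 'I_m * 'I_m | theta ab.1 - theta ab.2 == h] is Some ab then
    g *+ ab.1 - g *+ ab.2 else 0.
have tauE (a b : 'I_m) : tau (theta a - theta b) = g *+ a - g *+ b.
  rewrite /tau; case: pickP => [[a' b'] /= /eqP /hdiff e|/(_ (a, b))]; last by rewrite eqxx.
  by apply/eqP; rewrite subr_eq addrAC eq_sym subr_eq -!mulrnDr e.
have digit (x i : nat) : ((x %/ m ^ i) %% m < m)%N by rewrite ltn_mod.
have expand (x : nat) : (x < m ^ k)%N -> (\sum_(i < k) (x %/ m ^ i) %% m * m ^ i = x)%N.
  have ex l : (\sum_(i < l) (x %/ m ^ i) %% m * m ^ i = x %% m ^ l)%N.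
    elim: l => [|l IH]; first by rewrite big_ord0 expn0 modn1.
    rewrite big_ord_recr IH /= expnSr.
    have ml : (0 < m ^ l)%N by rewrite expn_gt0 m0.
    have lt : ((x %/ m ^ l) %% m * m ^ l + x %% m ^ l < m ^ l * m)%N.
      apply: leq_trans (_ : ((x %/ m ^ l) %% m).+1 * m ^ l <= _)%N.
        by rewrite mulSn addnC ltn_add2r ltn_mod.
      by rewrite mulnC leq_mul2l ltn_mod m0 orbT.
    rewrite [in RHS](divn_eq x (m ^ l)) [in RHS](divn_eq (x %/ m ^ l) m).
    by rewrite mulnDl -addnA -mulnA [(m * m ^ l)%N]mulnC modnMDl (modn_small lt) addnC.
  by move=> h; rewrite ex modn_small.
exists (fun x : 'I_n.+1 => [ffun i : 'I_k => Ordinal (digit x i)]),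
  (fun h : {ffun 'I_k -> H} => \sum_(i < k) tau (h i) *+ m ^ i) => x y.
have hx (z : 'I_n.+1) : z = \sum_(i < k) g *+ ((z %/ m ^ i) %% m) *+ m ^ i.
  under eq_bigr do rewrite -mulrnA.
  have zm : (z < m ^ k)%N by apply: leq_ltn_trans nmk; rewrite -ltnS.
  rewrite sumrMnr expand //.
  by rewrite -[LHS]valZpK; exact/esym/Zp_gen_mulrn.
rewrite [in RHS](hx x) [in RHS](hx y) -sumrB; apply: eq_bigr => i _.
by rewrite !ffunE tauE mulrnBl.
Qed.

Section BigCyclic.
Variables (m : nat) (H : finZmodType) (theta : 'I_m -> H).
Hypothesis hdiff : forall a b a' b' : 'I_m,
  theta a - theta b = theta a' - theta b' -> (a + b' = a' + b)%N.

(** A factor of order N > m^m takes k > m digits, with m^(k - 1) < N; the overshoot m^k / N is less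
    than m, hence than 2^k. *)
Lemma box_big_cyclic ns : (1 < m)%N -> all (fun n => (m ^ m < n.+1)%N) ns ->
  exists2 I : finType, box theta (prodZ ns) I & (m ^ #|I| <= 2 ^ #|I| * #|prodZ ns|)%N.
Proof.
move=> m1; have m0 : (0 < m)%N by apply: ltnW.
elim: ns => [_|n ns IH /= /andP[hn /IH [I hI hc]]].
  exists void; last by rewrite card_void card_ord.
  exists (fun _ => [ffun i : void => match i with end]), (fun _ => 0) => x y.
  by rewrite [x]ord1 [y]ord1 subrr.
pose k := up_log m n.+1.
exists ('I_k + I)%type.
  by apply: box_pair hI; apply: box_cyc => //; apply: up_logP.
have mk : (m < k)%N.
  rewrite -(ltn_exp2l _ _ m1); apply: leq_trans hn _; exact: up_logP.
rewrite card_sum !expnD card_prod mulnACA leq_mul // !card_ord.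
have k0 : (0 < k)%N by apply: leq_trans mk.
rewrite -(prednK k0) expnS; apply: leq_mul.
  by apply: leq_trans (ltnW (ltn_expl m (ltnSn 1))) _; rewrite leq_exp2l // prednK // ltnW.
apply: ltnW; apply: up_log_gtn => //.
by apply: leq_ltn_trans hn; rewrite expn_gt0 m0.
Qed.

End BigCyclic.

Lemma embeds_cat s1 s2 : exists (f : prodZ (s1 ++ s2) -> (prodZ s1 * prodZ s2)%type)
  (f' : (prodZ s1 * prodZ s2)%type -> prodZ (s1 ++ s2)), embeds f f'.
Proof.
elim: s1 => [|n s1 [f [f' hf]]].
  by exists (fun x => (0, x)), (fun z => z.2).
exists (fun x => ((x.1, (f x.2).1), (f x.2).2)), (fun z => (z.1.1, f' (z.1.2, z.2))).
move=> [x1 x2] [y1 y2] /=; congr pair.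
by rewrite -hf; congr f'; case: (f x2) (f y2) => [? ?] [? ?].
Qed.

Lemma embeds_prefix s1 s2 : exists (f : prodZ s1 -> prodZ (s1 ++ s2))
  (f' : prodZ (s1 ++ s2) -> prodZ s1), embeds f f'.
Proof.
elim: s1 => [|n s1 [f [f' hf]]].
  by exists (fun=> 0), (fun=> 0) => x y; rewrite [x]ord1 [y]ord1 subrr.
exists (fun x => (x.1, f x.2)), (fun z => (z.1, f' z.2)).
by move=> [x1 x2] [y1 y2] /=; congr pair; rewrite -hf.
Qed.

Lemma embeds_filter (p : pred nat) s :
  exists (f : prodZ s -> (prodZ (filter p s) * prodZ (filter (predC p) s))%type)
  (f' : (prodZ (filter p s) * prodZ (filter (predC p) s))%type -> prodZ s), embeds f f'.
Proof.
elim: s => [|n s [f [f' hf]]].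
  by exists (fun x => (x, 0)), (fun z => z.1).
rewrite /=; case: (p n) => /=.
  exists (fun x => ((x.1, (f x.2).1), (f x.2).2)), (fun z => (z.1.1, f' (z.1.2, z.2))).
  move=> [x1 x2] [y1 y2] /=; congr pair.
  by rewrite -hf; congr f'; case: (f x2) (f y2) => [? ?] [? ?].
exists (fun x => ((f x.2).1, (x.1, (f x.2).2))), (fun z => (z.2.1, f' (z.1, z.2.2))).
move=> [x1 x2] [y1 y2] /=; congr pair.
by rewrite -hf; congr f'; case: (f x2) (f y2) => [? ?] [? ?].
Qed.

Lemma card_prodZ_cat s1 s2 : #|prodZ (s1 ++ s2)| = (#|prodZ s1| * #|prodZ s2|)%N.
Proof. by rewrite !card_prodZ big_cat. Qed.

Lemma card_prodZ_filter (p : pred nat) s :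
  #|prodZ s| = (#|prodZ (filter p s)| * #|prodZ (filter (predC p) s)|)%N.
Proof. by rewrite !card_prodZ !big_filter (bigID p). Qed.

(** The factors are packed r at a time; padding the last pack with zeros costs at most the order of
    one pack. *)
Lemma box_small_cyclic n r k : (0 < r)%N ->
  exists2 I : finType, box (@id (prodZ (nseq r n))) (prodZ (nseq k n)) I &
    (#|prodZ (nseq r n)| ^ #|I| <= #|prodZ (nseq r n)| * 2 ^ #|I| * #|prodZ (nseq k n)|)%N.
Proof.
move=> r0; elim/ltn_ind: k => k IH; have [kr|rk] := leqP k r.
  have [f [f' hf]] := embeds_prefix (nseq k n) (nseq (r - k) n).
  rewrite -nseqD subnKC // in f f' hf.
  exists unit.
    exists (fun x => [ffun=> f x]), (fun h => f' (h tt)) => x y.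
    by rewrite !ffunE hf.
  by rewrite card_unit !expn1 -mulnA leq_pmulr // muln_gt0 /= card_zmod_gt0.
have [I hI hc] := IH (k - r)%N (ltac:(by rewrite ltn_subrL r0 (leq_ltn_trans _ rk))).
have [f [f' hf]] := embeds_cat (nseq r n) (nseq (k - r) n).
have ek : nseq r n ++ nseq (k - r) n = nseq k n by rewrite -nseqD subnKC // ltnW.
exists (unit + I)%type.
  rewrite -ek; apply: box_embed hf _; apply: box_pair hI.
  by exists (fun x => [ffun=> x]), (fun h => h tt) => x y; rewrite !ffunE.
rewrite card_sum card_unit !expnD !expn1 -ek card_prodZ_cat.
have := leq_mul (leqnn #|prodZ (nseq r n)|) hc.
move/leq_trans; apply.
move: (2 ^ #|I|)%N #|prodZ (nseq r n)| #|prodZ (nseq (k - r) n)| => a b c.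
have -> : (b * (2 * a) * (b * c) = 2 * (b * (b * a * c)))%N by ring.
by rewrite leq_pmull.
Qed.

End Boxes.

(** * Decomposition of finite abelian groups into cyclic groups *)

Section Structure.

Lemma zmod_cyclic_cover (G : finZmodType) (b : seq G) :
  exists psi : prodZ [seq #[x]%g.-1 | x <- b] -> G,
    (forall h h', psi (h + h') = psi h + psi h') /\
    (forall g, g \in (\prod_(x <- b) <[x]>)%g -> exists h, psi h = g).
Proof.
elim: b => [|x b [psi [hD hs]]].
  exists (fun=> 0); split=> [h h'|g]; first by rewrite addr0.
  by rewrite big_nil => /set1gP ->; exists 0.
have xN : x *+ (#[x]%g.-1).+1 = 0.
  by rewrite prednK ?order_gt0 // -FinRing.Theory.zmodXgE expg_order.
have xmod k : x *+ (k %% (#[x]%g.-1).+1) = x *+ k.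
  by rewrite [in RHS](divn_eq k (#[x]%g.-1).+1) mulrnDr mulnC mulrnA xN mul0rn add0r.
exists (fun z : 'I_(#[x]%g.-1).+1 * prodZ [seq #[x]%g.-1 | x <- b] =>
  x *+ z.1 + psi z.2); split=> [[k h] [k' h']|g] /=.
  by rewrite hD xmod mulrnDr addrACA.
rewrite big_cons => /mulsgP[y z /cycleP[k ->] /hs[h <-] ->].
by exists (inZp k, h); rewrite /= xmod FinRing.Theory.zmodXgE.
Qed.

(** Any section f of an additive surjection psi satisfies [embeds f psi], so a surjection from the
    product of cyclic groups suffices. *)
Lemma zmod_embeds_prodZ (G : finZmodType) :
  exists (ns : seq nat) (f : G -> prodZ ns) (f' : prodZ ns -> G),
    [/\ all (leq 1) ns, embeds f f' & #|G| = #|prodZ ns|].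
Proof.
have [b hb ho] := abelian_structure (FinRing.Theory.zmod_abelian [set: G]).
have [psi [hD hs]] := zmod_cyclic_cover b.
have hex (g : G) : exists h, psi h = g.
  by apply: hs; rewrite (bigdprodW hb) inE.
have [f hf] := fin_all_exists hex.
exists [seq #[x]%g.-1 | x <- b], f, psi; split.
- have := abelian_type_gt1 [set: G]; rewrite -ho !all_map; apply: sub_all => x /=.
  by rewrite -ltnS; case: #[x]%g.
- by move=> x y; apply/eqP; rewrite eq_sym subr_eq -[X in _ + X]hf -hD subrK hf.
- have := bigdprod_card hb; rewrite cardsT => <-.
  rewrite card_prodZ big_map; apply: eq_bigr => x _.
  by rewrite prednK ?order_gt0.
Qed.

End Structure.

(** * Cyclic groups of pairwise coprime orders *)

Section CRT.

Fixpoint prodZ_one ns : prodZ ns :=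
  if ns is n :: ns' then (inZp 1, prodZ_one ns') else 0.

(** Chinese remainder theorem: (1, ..., 1) generates the product. *)
Lemma prodZ_one_mulrn_inj ns a b : pairwise coprime [seq n.+1 | n <- ns] ->
  prodZ_one ns *+ a = prodZ_one ns *+ b -> a = b %[mod #|prodZ ns|].
Proof.
rewrite card_prodZ; elim: ns => [|n ns IH] /=; first by rewrite big_nil !modn1.
move=> /andP[hc hp]; rewrite big_cons.
have hmul k : (inZp 1, prodZ_one ns) *+ k = (inZp k, prodZ_one ns *+ k) :> prodZ (n :: ns).
  elim: k => [|k IHk]; first by rewrite !mulr0n; congr pair; apply: val_inj => /=; rewrite mod0n.
  rewrite !mulrSr IHk; congr pair; apply: val_inj => /=.
  by rewrite modnDm addn1.
rewrite !hmul => -[/eqP h1 h2]; apply/eqP.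
rewrite chinese_remainder; last first.
  elim: (ns) hc => [|n' s IHs] /=; first by rewrite big_nil coprimen1.
  by move=> /andP[h3 h4]; rewrite big_cons coprimeMr h3 IHs.
by rewrite (eqP h1) eqxx /= (IH hp h2).
Qed.

(* The orders are 1 + (k + 1) r!, pairwise coprime and all between r! and (r!)^3. *)
Definition godel_moduli r := [seq (i.+1 * r`!)%N | i <- iota 0 r].

(** A common divisor of two moduli divides the difference j - i of their indices, hence r!, hence
    1. *)
Lemma godel_moduli_coprime r : pairwise coprime [seq n.+1 | n <- godel_moduli r].
Proof.
rewrite -map_comp; apply/(pairwiseP 0%N) => i j; rewrite !inE size_map size_iota => hi hj ij.
rewrite !(nth_map 0%N) ?size_iota // !nth_iota //= !add0n.
set F := r`!; set d := gcdn (i.+1 * F).+1 (j.+1 * F).+1.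
have d1 : (d %| (i.+1 * F).+1)%N by exact: dvdn_gcdl.
have d2 : (d %| (j.+1 * F).+1)%N by exact: dvdn_gcdr.
have d3 : (d %| j - i)%N.
  have -> : (j - i = j.+1 * (i.+1 * F).+1 - i.+1 * (j.+1 * F).+1)%N.
    rewrite !mulnS (mulnCA i.+1) addnC (addnC i.+1) subnDl subSS //.
  by apply: dvdn_sub; apply: dvdn_mull.
have d4 : (d %| F)%N.
  apply: dvdn_trans d3 (dvdn_fact _).
  by rewrite subn_gt0 ij /= (leq_trans (leq_subr _ _)) // ltnW.
have : (d %| 1)%N by rewrite -(dvdn_addr 1 (dvdn_mull i.+1 d4)) addn1.
by rewrite dvdn1.
Qed.

End CRT.

(** * Assembling the classes of groups *)

Section Assembly.
Variable R : realType.
Local Notation C := R[i].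

Lemma leq_exp_pow (T j : nat) : (2 <= T)%N -> (0 < j)%N -> (j <= T ^ (j ^ 4))%N.
Proof.
move=> T2 j0; apply: leq_trans (ltnW (ltn_expl j T2)) _.
by rewrite leq_exp2l // -[X in (X <= _)%N]expn1 leq_pexp2l.
Qed.

(** Here X is the whole group H, a power of one cyclic group, and T = Q = n + 1. *)
Lemma power_block (eps c : R) (m0 n : nat) : 0 < eps -> 0 < c -> (0 < n)%N ->
  exists2 r, (0 < r)%N & good_block eps c m0 (@bichar_prodZ R (nseq r n))
    (@id (prodZ (nseq r n))).
Proof.
move=> eps0 c0 n0; have [j0 hj0] := prodZ_splits eps0 c0.
pose j := maxn j0 (maxn m0 1).
have jj0 : (j0 <= j)%N by rewrite leq_maxl.
have jm0 : (m0 <= j)%N by rewrite /j maxnCA leq_maxl.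
have j1 : (0 < j)%N by rewrite /j maxnA leq_maxr.
exists (j ^ 4)%N; first by rewrite expn_gt0 j1.
have hall T : (T <= n.+1 <= n.+1)%N -> all (fun k => (T <= k.+1 <= n.+1)%N) (nseq (j ^ 4) n).
  by move=> h; apply/allP => k /nseqP[-> _].
have hc : (j <= #|prodZ (nseq (j ^ 4) n)|)%N.
  rewrite card_prodZ; apply: leq_trans (leq_exp_pow (T := n.+1) _ j1) _ => //.
  rewrite -{1}(size_nseq (j ^ 4) n).
  by apply/leq_prodn_const/sub_all/(hall n.+1) => [k /andP[] //|]; rewrite leqnn.
split.
- exact: bichar_prodZP.
- by [].
- exact: leq_trans hc.
- by rewrite leq_pmull.
- apply: (hj0 j n.+1 n.+1) => //; first by rewrite size_nseq.
    by apply: hall; rewrite leqnn.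
  (* The exponents 6, 4 j and 3 cover 34 <= 2^6, j^4 <= (2^j)^4 and Q^3. *)
  apply: leq_trans (_ : n.+1 ^ (6 + 4 * j + 3) <= _)%N; last by rewrite leq_pexp2l //; lia.
  rewrite (expnD _ (6 + 4 * j)) (expnD _ 6).
  apply: leq_mul => //; apply: leq_mul.
    by apply: leq_trans (_ : 2 ^ 6 <= _)%N => //; rewrite leq_exp2r.
  rewrite mulnC expnM leq_exp2r //; apply: ltnW.
  by apply: leq_trans (ltn_expl j (ltnSn 1)) _; rewrite leq_exp2r.
Qed.

Lemma fact_ge r : (r <= r`!)%N.
Proof. by case: r => // r; rewrite factS leq_pmulr // fact_gt0. Qed.

(** H is cyclic, generated by (1, ..., 1), and the digit a is sent to the a-th multiple of this
    generator. *)
Lemma crt_block (eps c : R) (m0 : nat) : 0 < eps -> 0 < c ->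
  exists m ns (theta : 'I_m -> prodZ ns), [/\ (1 < m)%N,
    good_block eps c m0 (@bichar_prodZ R ns) theta &
    forall a b a' b' : 'I_m,
      theta a - theta b = theta a' - theta b' -> (a + b' = a' + b)%N].
Proof.
(* The rank is compared with m instead of M = |H|, and M <= 3 m. *)
move=> eps0 c0; have c30 : 0 < c / 3 by rewrite divr_gt0.
have [j0 hj0] := prodZ_splits eps0 c30.
pose j := maxn j0 (maxn (2 * m0) 4).
have jj0 : (j0 <= j)%N by rewrite leq_maxl.
have jm0 : (2 * m0 <= j)%N by rewrite /j maxnCA leq_maxl.
have j4 : (4 <= j)%N by rewrite /j maxnA leq_maxr.
have j1 : (0 < j)%N by apply: leq_trans j4.
pose r := (j ^ 4)%N; pose ns := godel_moduli r.
have r4 : (4 <= r)%N by apply: leq_trans j4 _; rewrite -[X in (X <= _)%N]expn1 leq_pexp2l.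
(* Half of M, rounded up: a sum of two digits is at most 2 m - 2 < M, so it is determined modulo
   M. *)
pose T := r`!; pose M := #|prodZ ns|; pose m := uphalf M.
have rT : (r <= T)%N := fact_ge r.
have T2 : (2 <= T)%N by apply: leq_trans rT; apply: leq_trans r4.
have hns : all (fun n => (T <= n.+1 <= T ^ 3)%N) ns.
  apply/allP => n /mapP[k hk ->]; move: hk; rewrite mem_iota add0n => /andP[_ kr].
  rewrite leqW ?leq_pmull // -/T; apply: leq_ltn_trans (_ : T * T < _)%N.
    by rewrite leq_mul // (leq_trans kr).
  by rewrite mulnn ltn_exp2l.
have jM : (j <= M)%N.
  apply: leq_trans (leq_exp_pow T2 j1) _; rewrite /M card_prodZ.
  have -> : (j ^ 4)%N = size ns by rewrite size_map size_iota.
  by apply: leq_prodn_const; apply: sub_all hns => n /andP[].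
have [mM Mm] : (2 * m <= M.+1)%N /\ (M <= 2 * m)%N by rewrite /m; lia.
pose theta (a : 'I_m) := prodZ_one ns *+ a.
have hdiff (a b a' b' : 'I_m) :
    theta a - theta b = theta a' - theta b' -> (a + b' = a' + b)%N.
  move=> /eqP; rewrite subr_eq addrAC eq_sym subr_eq -!mulrnDr => /eqP /esym.
  move=> /(prodZ_one_mulrn_inj (godel_moduli_coprime r)); rewrite -/M.
  have lt (x y : 'I_m) : (x + y < M)%N.
    by have := ltn_ord x; have := ltn_ord y; lia.
  by rewrite !modn_small.
have hinj : injective theta.
  by move=> a b e; apply: val_inj; have := hdiff a a b a; rewrite e => /(_ erefl) /addIn.
exists m, ns, theta; split=> //; first by lia.
split=> //.
- exact: bichar_prodZP.
- by rewrite card_ord; lia.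
- by rewrite card_ord -/M; lia.
have [] := hj0 j T (T ^ 3)%N ns => //.
- by rewrite size_map size_iota.
- rewrite -expnM.
  (* The exponents cover 34 <= 2^6, j^4 = r <= T and Q^3 = T^9. *)
  apply: leq_trans (_ : T ^ (6 + 1 + 3 * 3) <= _)%N; last by rewrite leq_pexp2l ?(ltnW T2) //; lia.
  rewrite (expnD _ (6 + 1)) (expnD _ 6) expn1 leq_mul // leq_mul //.
  by apply: leq_trans (_ : 2 ^ 6 <= _)%N => //; rewrite leq_exp2r.
move=> S [hL hS]; exists (fun x => S (theta x)); split; last exact: l1_le_inj.
apply: rank_leW (rank_le_restrict theta id hL).
rewrite mulrAC ler_pdivrMr // -mulrA ler_wpM2l ?(ltW c0) // -natrM ler_nat card_ord.
by rewrite -/M; lia.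
Qed.

Lemma constants_exist (eps : R) : 0 < eps ->
  exists (c : R) (m0 : nat), [/\ 0 < c, c <= 1, c `^ eps <= 8^-1, (4 <= m0)%N &
    6 <= m0%:R `^ eps].
Proof.
move=> eps0; have [N hN] := @powR_large R eps 6 eps0.
exists (8 `^ (- eps^-1)), (maxn 4 N); split.
- by rewrite powR_gt0.
- by rewrite -[leRHS](powRr0 8) ler_powR ?ler1n // oppr_le0 invr_ge0 ltW.
- by rewrite -powRrM mulNr mulVf ?gt_eqF // powR_inv1.
- exact: leq_maxl.
- by apply: hN; exact: leq_maxr.
Qed.

Lemma tame_class_sub (P Q : finZmodType -> Prop) (eta : R) :
  tame_class Q eta -> (forall G, P G -> Q G) -> tame_class P eta.
Proof. by move=> [a [K [a0 K1 hQ]]] h; exists a, K; split=> // G /h /hQ. Qed.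

Lemma tame_big_cyclic (eta : R) : 0 < eta -> exists q, tame_class (fun G =>
  exists2 ns, all (fun n => (q <= n)%N) ns & G = prodZ ns) eta.
Proof.
move=> eta0; pose eps := Num.min (eta / 16) 1.
have eps0 : 0 < eps by rewrite lt_min divr_gt0 ?ltr01.
have eps1 : eps <= 1 by rewrite ge_min lexx orbT.
have [c [m0 [c0 c1 hc m4 h6]]] := constants_exist eps0.
have [m [ns [theta [m1 hgood hdiff]]]] := crt_block m0 eps0 c0.
exists (m ^ m)%N; apply: (@tame_class_le _ _ (16 * eps)).
  by rewrite mulrC -ler_pdivlMr // ge_min lexx.
apply: tame_class_sub (tame_box eps0 eps1 c0 c1 hc m4 h6 (ltn0Sn 0) hgood) _.
move=> G [s hs ->]; have [I hI hcard] := box_big_cyclic hdiff m1 hs.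
by exists I; rewrite // card_ord mul1n.
Qed.

Lemma tame_power (eta : R) n : 0 < eta -> (0 < n)%N -> tame_class (fun G =>
  exists k, G = prodZ (nseq k n)) eta.
Proof.
move=> eta0 n0; pose eps := Num.min (eta / 16) 1.
have eps0 : 0 < eps by rewrite lt_min divr_gt0 ?ltr01.
have eps1 : eps <= 1 by rewrite ge_min lexx orbT.
have [c [m0 [c0 c1 hc m4 h6]]] := constants_exist eps0.
have [r r0 hgood] := power_block m0 eps0 c0 n0.
apply: (@tame_class_le _ _ (16 * eps)).
  by rewrite mulrC -ler_pdivlMr // ge_min lexx.
have X0 := card_zmod_gt0 (prodZ (nseq r n)).
apply: tame_class_sub (tame_box eps0 eps1 c0 c1 hc m4 h6 X0 hgood) _.
move=> G [k ->]; have [I hI hcard] := box_small_cyclic n k r0.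
by exists I.
Qed.

(** Each product of classes doubles eta, so only boundedly many are affordable: equal factors are
    collected first, and the induction on q splits off those with entry q + 1. *)
Lemma tame_small_cyclic (q : nat) (eta : R) : 0 < eta -> tame_class (fun G =>
  exists2 ns, all (fun n => (0 < n <= q)%N) ns & G = prodZ ns) eta.
Proof.
elim: q eta => [|q IH] eta eta0.
  apply: tame_class_sub (tame_power eta0 (ltn0Sn 0)) _ => G [ns hns ->].
  by exists 0%N; case: ns hns => //= n ns; case: n.
pose e := Num.min (eta / 2) (1 / 2).
have e0 : 0 < e by rewrite lt_min !divr_gt0.
have e1 : e <= 1 / 2 by rewrite ge_min lexx orbT.
apply: (@tame_class_le _ _ (2 * e)).
  by rewrite mulrC -ler_pdivlMr // ge_min lexx.
apply: tame_class_embed (tame_class_pair e0 e1 (tame_power e0 (ltn0Sn q)) (IH e e0)) _.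
move=> G [ns hns ->].
have [f [f' hf]] := embeds_filter (pred1 q.+1) ns.
exists (prodZ (filter (pred1 q.+1) ns) * prodZ (filter (predC (pred1 q.+1)) ns))%type, f, f'.
split=> //; last by rewrite card_prod -card_prodZ_filter.
exists (prodZ (filter (pred1 q.+1) ns)), (prodZ (filter (predC (pred1 q.+1)) ns)); split=> //.
  exists (size (filter (pred1 q.+1) ns)); congr prodZ.
  by apply/all_pred1P/filter_all.
exists (filter (predC (pred1 q.+1)) ns) => //.
apply/allP => n; rewrite mem_filter /= => /andP[nq /(allP hns)] /andP[-> h].
by rewrite /= -ltnS ltn_neqAle nq.
Qed.

(** The threshold q between large and small cyclic factors depends only on eta, so the constants for
    the small ones are uniform in G. *)
Lemma tame_all (eta : R) : 0 < eta -> tame_class (fun _ => True) eta.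
Proof.
move=> eta0; pose e := Num.min (eta / 2) (1 / 2).
have e0 : 0 < e by rewrite lt_min !divr_gt0.
have e1 : e <= 1 / 2 by rewrite ge_min lexx orbT.
have [q hq] := tame_big_cyclic e0.
apply: (@tame_class_le _ _ (2 * e)).
  by rewrite mulrC -ler_pdivlMr // ge_min lexx.
apply: tame_class_embed (tame_class_pair e0 e1 hq (tame_small_cyclic q e0)) _.
move=> G _; have [ns [f [f' [hns hf hc]]]] := zmod_embeds_prodZ G.
have [g [g' hg]] := embeds_filter (leq q) ns.
exists (prodZ (filter (leq q) ns) * prodZ (filter (predC (leq q)) ns))%type, (g \o f), (f' \o g').
split; last by rewrite hc card_prod -card_prodZ_filter.
  exists (prodZ (filter (leq q) ns)), (prodZ (filter (predC (leq q)) ns)); split=> //.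
    by exists (filter (leq q) ns); rewrite // filter_all.
  exists (filter (predC (leq q)) ns) => //.
  apply/allP => n; rewrite mem_filter /= => /andP[nq /(allP hns) ->].
  by rewrite ltnW // ltnNge.
exact: embeds_trans hf hg.
Qed.

End Assembly.

Unset Implicit Arguments.

Theorem proposition1p7 (R : realType) (eta : R) (heta : 0 < eta) :
  exists (a : R) (N0 : nat),
    0 < a /\
    forall (G : finZmodType) (f : G -> R[i]),
      (N0 <= #|G|)%N ->
      (forall x : G, Normc.normc (f x) <= 1) ->
      exists B : 'M[R[i]]_#|G|,
        (\rank B)%:R <= (#|G|%:R : R) `^ (1 - a) /\
        norm1oo (circulant f - B) <= (#|G|%:R : R) `^ (1 / 2 + eta).
Proof.
apply: circulant_of_tame => //; apply: tame_all.
by rewrite divr_gt0.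
Qed.
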